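(* Let $1<p<+\infty$. For quasi-all functions $f\in L^p(\mathbb T)$, the following holds: for any $\beta\in[0,1/p]$, $\dim_{\mathcal H}\big(E(\beta,f)\big)=1-\beta p$.
   Context: $\mathbb T=\mathbb R/\mathbb Z$ with Lebesgue measure. For $k\in\mathbb Z$, $e_k(t)=e^{2\pi i k t}$; for $g\in L^1(\mathbb T)$ and an integer $n\ge 0$, $S_ng(t)=\sum_{k=-n}^n\langle g,e_k\rangle e_k(t)$, where $\langle g,e_k\rangle=\int_{\mathbb T} g\,\overline{e_k}$, is the $n$-th partial sum of the Fourier series of $g$. For $f\in L^p(\mathbb T)$ and $x\in\mathbb T$, the divergence index $\beta(x)$ of the Fourier series of $f$ at $x$ is the infimum of the non-negative real numbers $\beta$ such that $|S_nf(x)|=O(n^\beta)$ as $n\to+\infty$. For $\beta\ge 0$, $E(\beta,f)=\{x\in\mathbb T:\ \beta(x)=\beta\}$ (for $\beta>0$ this is $\{x\in\mathbb T:\ \limsup_{n\to+\infty}\frac{\log|S_nf(x)|}{\log n}=\beta\}$). $\dim_{\mathcal H}$ denotes Hausdorff dimension. ''For quasi-all functions $f\in L^p(\mathbb T)$'' means: for all $f$ in some residual subset (one containing a countable intersection of dense open sets) of $L^p(\mathbb T)$, the same residual set serving for all $\beta$. *)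

(* Defs.v *)
From HB Require Import structures.
From mathcomp Require Import all_boot all_order all_algebra.
From mathcomp Require Import all_classical all_reals all_analysis.
From mathcomp Require Import measurable_realfun generic_quotient complex.

Set Implicit Arguments.
Unset Strict Implicit.
Unset Printing Implicit Defensive.

Import Order.TTheory GRing.Theory Num.Theory.
Import numFieldNormedType.Exports.
Import Normc.

Local Open Scope classical_set_scope.
Local Open Scope ring_scope.
Local Open Scope complex_scope.
Local Open Scope quotient_scope.

(* The circle R/Z is represented by its fundamental domain [0, 1[.  Functions
   on the circle are functions on the line, considered through a measure that
   only sees this domain. *)
Definition circle (R : realType) : set (measurableTypeR R) := `[0, 1[%classic.

Lemma measurable_circle (R : realType) : measurable (@circle R).
Proof. exact: measurable_itv. Qed.

Definition circle_measure (R : realType) :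
    {measure set (measurableTypeR R) -> \bar R} :=
  mrestr (@lebesgue_measure R) (@measurable_circle R).

(* Distance from x - y to the nearest integer, i.e. the quotient distance. *)
Definition circle_dist (R : realType) (x y : R) : R :=
  let t := x - y - (Num.floor (x - y))%:~R in Num.min t (1 - t).

Lemma normc_ge0 (R : realType) (z : R[i]) : 0 <= normc z.
Proof. by case: z => a b /=; rewrite sqrtr_ge0. Qed.

Lemma ler_normcD (R : realType) (x y : R[i]) :
  normc (x + y) <= normc x + normc y.
Proof.
by have := ler_normD x y; case: x => a b; case: y => c d;
  rewrite lecE /= => /andP[].
Qed.

Lemma normc_opp (R : realType) (z : R[i]) : normc (- z) = normc z.
Proof. by case: z => a b /=; rewrite !sqrrN. Qed.

Section Lp.
Context (R : realType) (p : R).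
Let mu := @circle_measure R.

(* Measurable complex functions with finite L^p norm, before identification of
   the functions that agree almost everywhere. *)
Record cLfun := CLfun {
  cLfun_fun :> measurableTypeR R -> R[i];
  cLfun_Re : measurable_fun setT (@complex.Re R \o cLfun_fun);
  cLfun_Im : measurable_fun setT (@complex.Im R \o cLfun_fun);
  cLfun_finite : finite_norm mu p%:E (@normc R \o cLfun_fun) }.

HB.instance Definition _ := gen_eqMixin cLfun.
HB.instance Definition _ := gen_choiceMixin cLfun.

Definition cLfun_ae_eq (f g : cLfun) : bool :=
  `[< (f : _ -> _) = g %[ae mu] >].

Let cLfun_ae_eq_refl : reflexive cLfun_ae_eq.
Proof. by move=> f; apply/asboolP/aeW. Qed.

Let cLfun_ae_eq_sym : symmetric cLfun_ae_eq.
Proof.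
by move=> f g; apply/idP/idP => /asboolP h; apply/asboolP;
  apply: filterS h => x h /h.
Qed.

Let cLfun_ae_eq_trans : transitive cLfun_ae_eq.
Proof.
move=> f g h /asboolP gf /asboolP fh; apply/asboolP.
by apply: filterS2 gf fh => x a b xT; rewrite a// b.
Qed.

Canonical cLfun_ae_eq_canonical :=
  EquivRel cLfun_ae_eq cLfun_ae_eq_refl cLfun_ae_eq_sym cLfun_ae_eq_trans.

(* The argument 1 <= p is carried by the type so that the metric structure
   below can be inferred from it. *)
Definition cLspace of 1 <= p : Type := {eq_quot cLfun_ae_eq}.

Context (p1 : 1 <= p).

HB.instance Definition _ := Choice.on (cLspace p1).
HB.instance Definition _ := EqQuotient.on (cLspace p1).
Definition cLspace_to_fun (f : cLspace p1) : measurableTypeR R -> R[i] :=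
  repr f.
Coercion cLspace_to_fun : cLspace >-> Funclass.

Lemma cLspaceP (f g : cLspace p1) :
  (f : _ -> _) = g %[ae mu] <-> f = g.
Proof.
split=> [fg|->]; last exact: aeW.
rewrite -(reprK f) -(reprK g); apply/eqmodP; exact/asboolP.
Qed.

Lemma measurable_cLdiff (f g : cLfun) :
  measurable_fun setT (fun t => normc (f t - g t)).
Proof.
have -> : (fun t => normc (f t - g t)) = (fun t => Num.sqrt
   ((@complex.Re R (f t) - @complex.Re R (g t)) ^+ 2 +
    (@complex.Im R (f t) - @complex.Im R (g t)) ^+ 2)).
  by apply/funext => t; case: (f t) => a b; case: (g t).
apply: (@measurableT_comp _ _ _ _ _ _ (@Num.sqrt R)).
  apply: continuous_measurable_fun; exact: sqrt_continuous.
apply: measurable_funD; apply: measurable_funX; apply: measurable_funB.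
- exact: cLfun_Re.
- exact: cLfun_Re.
- exact: cLfun_Im.
- exact: cLfun_Im.
Qed.


Definition cLnorm (f : measurableTypeR R -> R[i]) : \bar R :=
  Lnorm mu p%:E (EFin \o (@normc R \o f)).

Lemma measurable_cLfun (f : cLfun) : measurable_fun setT (@normc R \o f).
Proof.
have -> : @normc R \o f = (fun t => Num.sqrt
   ((@complex.Re R (f t)) ^+ 2 + (@complex.Im R (f t)) ^+ 2)).
  by apply/funext => t /=; case: (f t).
apply: (@measurableT_comp _ _ _ _ _ _ (@Num.sqrt R)).
  apply: continuous_measurable_fun; exact: sqrt_continuous.
by apply: measurable_funD; apply: measurable_funX;
  [exact: cLfun_Re|exact: cLfun_Im].
Qed.

Lemma le_Lnorm (f g : measurableTypeR R -> R) :
  measurable_fun setT f -> measurable_fun setT g ->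
  (forall t, 0 <= f t <= g t) ->
  (Lnorm mu p%:E (EFin \o f) <= Lnorm mu p%:E (EFin \o g))%E.
Proof.
move=> mf mg fg.
have p0 : 0 < p by exact: lt_le_trans p1.
rewrite unlock; apply: gt0_ler_poweR.
- by rewrite invr_ge0 ltW.
- by rewrite in_itv/= leey integral_ge0// => t _; exact: poweR_ge0.
- by rewrite in_itv/= leey integral_ge0// => t _; exact: poweR_ge0.
have mpow (h : measurableTypeR R -> R) : measurable_fun setT h ->
    measurable_fun setT (fun x => `|(EFin \o h) x| `^ p)%E.
  move=> mh; apply/measurable_EFinP.
  apply/(@measurableT_comp _ _ _ _ _ _ (fun x : R => x `^ p)%R) => //.
  exact: measurableT_comp.
apply: ge0_le_integral => //.
- by move=> t _; exact: poweR_ge0.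
- exact: mpow.
- exact: mpow.
move=> t _ /=; have /andP[f0 fgt] := fg t.
rewrite lee_fin !ger0_norm ?(le_trans f0)//.
apply: ge0_ler_powR => //; [exact: ltW|by rewrite nnegrE (le_trans f0)].
Qed.

Lemma cLdiff_triangle (f g h : cLfun) :
  (cLnorm (f \- h)%R <= cLnorm (f \- g)%R + cLnorm (g \- h)%R)%E.
Proof.
apply: le_trans (@minkowski_EFin _ _ _ mu _ _ _ (measurable_cLdiff f g)
  (measurable_cLdiff g h) p1).
apply: le_Lnorm.
- exact: measurable_cLdiff.
- by apply: measurable_funD; exact: measurable_cLdiff.
move=> t /=; rewrite normc_ge0/=.
by apply: le_trans (ler_normcD _ _); rewrite addrA subrK.
Qed.

Lemma cLdiff_lty (f g : cLfun) : (cLnorm (f \- g)%R < +oo)%E.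
Proof.
apply: (@le_lt_trans _ _ (cLnorm f + cLnorm g)%E); last first.
  by apply: lte_add_pinfty; exact: cLfun_finite.
apply: le_trans (@minkowski_EFin _ _ _ mu _ _ _ (measurable_cLfun f)
  (measurable_cLfun g) p1).
apply: le_Lnorm.
- exact: measurable_cLdiff.
- by apply: measurable_funD; exact: measurable_cLfun.
move=> t /=; rewrite normc_ge0/=.
by apply: le_trans (ler_normcD _ _) _; rewrite normc_opp.
Qed.

Definition cLdist (f g : cLspace p1) : R :=
  fine (cLnorm (f \- g)).

Lemma cLdistE (f g : cLspace p1) : (cLdist f g)%:E = cLnorm (f \- g).
Proof. by rewrite fineK// ge0_fin_numE ?Lnorm_ge0// cLdiff_lty. Qed.

Let cLdistxx (f : cLspace p1) : cLdist f f = 0.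
Proof.
apply/EFin_inj; rewrite cLdistE.
apply: (etrans _ (@Lnorm0 _ _ _ mu p%:E _)).
  by apply: eq_Lnorm => t /=; rewrite subrr normc0.
by rewrite eqe gt_eqF// (lt_le_trans _ p1).
Qed.

Let cLdist_positivity f g : cLdist f g = 0 -> f = g.
Proof.
move=> fg0; apply/cLspaceP.
have : cLnorm (f \- g) = 0%E by rewrite -cLdistE fg0.
move=> /Lnorm_eq0_eq0 h.
have : EFin \o (@normc R \o (f \- g)) = \0%E %[ae mu].
  apply: h; last by rewrite lte_fin (lt_le_trans _ p1).
  apply/measurable_EFinP; exact: measurable_cLdiff.
apply: filterS => t /(_ I) /= [] /eq0_normc /eqP.
by rewrite subr_eq0 => /eqP.
Qed.

Let cLdist_sym f g : cLdist f g = cLdist g f.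
Proof.
congr fine; apply: eq_Lnorm => t /=.
by rewrite -normc_opp opprB.
Qed.

Let cLdist_triangle g f h : cLdist f h <= cLdist f g + cLdist g h.
Proof. by rewrite -lee_fin EFinD !cLdistE; exact: cLdiff_triangle. Qed.

HB.instance Definition _ := @isMetric.Build R (cLspace p1) cLdist
  cLdistxx cLdist_positivity cLdist_sym cLdist_triangle.

End Lp.

Definition residual (X : topologicalType) (A : set X) : Prop :=
  exists G : (set X)^nat,
    (forall n, open (G n) /\ dense (G n)) /\ \bigcap_n G n `<=` A.

Section Fourier.
Context (R : realType).
Implicit Types (g : measurableTypeR R -> R[i]) (k : int) (n : nat) (t : R).

Definition fourier_exp k t : R[i] :=
  cos (2 * trigo.pi * k%:~R * t) +i* sin (2 * trigo.pi * k%:~R * t).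

Definition Cintegral g : R[i] :=
  (\int[circle_measure R]_t @complex.Re R (g t)) +i* (\int[circle_measure R]_t @complex.Im R (g t)).

Definition fourier_coef g k : R[i] :=
  Cintegral (fun t => g t * (fourier_exp k t)^*).

Lemma fourier_coef_ae (p : R) (f g : cLfun p) k :
  (f : _ -> _) = g %[ae circle_measure R] ->
  fourier_coef f k = fourier_coef g k.
Proof.
move=> fg.
have mc (u : R -> R) : continuous u ->
    measurable_fun setT (fun t : measurableTypeR R =>
      u (2 * trigo.pi * k%:~R * t)).
  move=> cu; apply: (@measurableT_comp _ _ _ _ _ _ u).
    exact: continuous_measurable_fun.
  exact: measurable_funM.
have mRe (h : cLfun p) : measurable_fun setT
    (fun t => @complex.Re R (h t * (fourier_exp k t)^*)).
  rewrite [X in measurable_fun _ X](_ : _ = fun t =>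
      @complex.Re R (h t) * cos (2 * trigo.pi * k%:~R * t) -
      @complex.Im R (h t) * (- sin (2 * trigo.pi * k%:~R * t))).
    apply: measurable_funB; apply: measurable_funM.
    - exact: cLfun_Re.
    - exact: (mc _ (@continuous_cos R)).
    - exact: cLfun_Im.
    - by apply: measurable_funN; exact: (mc _ (@continuous_sin R)).
  by apply/funext => t; case: (h t).
have mIm (h : cLfun p) : measurable_fun setT
    (fun t => @complex.Im R (h t * (fourier_exp k t)^*)).
  rewrite [X in measurable_fun _ X](_ : _ = fun t =>
      @complex.Re R (h t) * (- sin (2 * trigo.pi * k%:~R * t)) +
      @complex.Im R (h t) * cos (2 * trigo.pi * k%:~R * t)).
    apply: measurable_funD; apply: measurable_funM.
    - exact: cLfun_Re.
    - by apply: measurable_funN; exact: (mc _ (@continuous_sin R)).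
    - exact: cLfun_Im.
    - exact: (mc _ (@continuous_cos R)).
  by apply/funext => t; case: (h t).
congr (_ +i* _); congr fine; apply: ae_eq_integral => //.
- by apply/measurable_EFinP; exact: mRe.
- by apply/measurable_EFinP; exact: mRe.
- by apply: filterS fg => t fgt tT; rewrite fgt.
- by apply/measurable_EFinP; exact: mIm.
- by apply/measurable_EFinP; exact: mIm.
- by apply: filterS fg => t fgt tT; rewrite fgt.
Qed.

(* The frequency k = i - n runs over -n, ..., n. *)
Definition fourier_sum n g t : R[i] :=
  \sum_(i < n.*2.+1)
    fourier_coef g (i%:Z - n%:Z) * fourier_exp (i%:Z - n%:Z) t.

(* For integrable g the set of exponents contains 1, so this infimum of real
   numbers is that of a nonempty set bounded below. *)
Definition divergence_index g t : R :=
  inf [set b : R | 0 <= b /\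
    (fun n => normc (fourier_sum n g t)) =O_\oo (fun n => n%:R `^ b)].

Definition divergence_level (b : R) g : set R :=
  [set t | circle t /\ divergence_index g t = b].

End Fourier.

Section Hausdorff.
Context (R : realType) (T : Type) (dist : T -> T -> R).
Implicit Types (A U : set T) (s d : R).
Local Open Scope ereal_scope.

(* The element 0 only matters for the empty set. *)
Definition diameter U : \bar R :=
  ereal_sup (0 |` [set (dist xy.1 xy.2)%:E | xy in U `*` U]).

(* Empty sets contribute 0, also when s = 0. *)
Definition hausdorff_content s d A : \bar R :=
  ereal_inf [set \sum_(i <oo | U i != set0) diameter (U i) `^ s
            | U in [set U : (set T)^nat |
                (forall i, diameter (U i) <= d%:E) /\ A `<=` \bigcup_i U i]].

Definition hausdorff_measure s A : \bar R :=
  ereal_sup [set hausdorff_content s d A | d in [set d | (0 < d)%R]].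

Definition hausdorff_dim A : \bar R :=
  ereal_inf [set s%:E | s in [set s | (0 <= s)%R /\ hausdorff_measure s A = 0]].

End Hausdorff.

(* Main.v *)
(* Upper bound, for every f in L^p.  For n < 2^N the Dirichlet kernel of order
   n is dominated, away from the ends of the circle, by a multiple of
   sum_(i <= N) 2^i 1_(|t| <= 2^-i).  If |S_n f(x)| > n^b for infinitely many
   n, then by pigeonhole (which only loses a factor N) and Hoelder, for every
   b' < b the measure |f|^p dt gives mass at least 2^(-i (1 - b' p)) to the
   interval of radius 2^-i around x, for infinitely many i.  Counting dyadic
   intervals of large mass, these x form a set of s-dimensional measure zero
   for s > 1 - b' p.  Powers of log n are harmless, so that no maximal theorem
   is needed.

   Lower bound, for generic f.  With e(t) = exp (2 i pi t), the function
   M^(1/p) (M^-1 sum_(k < M) e(k Q x))^2 has norm at most 1 in L^p, equals its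
   partial sums of order at least 2 M Q, and has size about M^(1/p) within
   1 / (16 Q M) of the multiples of 1 / Q.  As S_n g = O(log n) for bounded g,
   adding a small multiple of such a spike to a truncation of an arbitrary
   function of L^p shows that the functions close to one having these large
   partial sums form a dense open set; take Q = 2^(b m), M = 2^(a m), and
   intersect over all a, b and all lower bounds on m.  For f in the
   intersection and 0 < beta < 1 / p, letting a / (a + b) tend to beta p from
   below, a Cantor set of nonzero (1 - beta p)-dimensional measure consists of
   points with divergence index at least beta.  By the upper bound, those with
   a larger index have measure zero, and the level set keeps the rest. *)

Require Import Defs.
From mathcomp Require Import all_boot all_order all_algebra.
From mathcomp Require Import all_classical all_reals all_analysis.
From mathcomp Require Import measurable_realfun generic_quotient complex.
From mathcomp Require Import zify ring lra.
Import Order.TTheory GRing.Theory Num.Theory.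
Import numFieldNormedType.Exports.
Import Normc.
Local Open Scope classical_set_scope.
Local Open Scope ring_scope.
Set Implicit Arguments.
Unset Strict Implicit.

(** * Sets of Hausdorff measure zero *)

Lemma gt1_ltr_powR (R : realType) (a x y : R) :
  1 < a -> x < y -> a `^ x < a `^ y.
Proof.
move=> a1 xy; have a0 : 0 < a := lt_trans ltr01 a1.
by rewrite /powR gt_eqF// ltr_expR ltr_pM2r// ln_gt0.
Qed.

(* Integrated over a ball, for [L] a fraction of the mean of [y], this plays the
   role of Hoelder's inequality. *)
Lemma le_addr_powR (R : realType) (p L y : R) : 1 <= p -> 0 < L -> 0 <= y ->
  y <= L + L `^ (1 - p) * y `^ p.
Proof.
move=> p1 L0 y0; have [yL|yL] := lerP y L.
  by rewrite (le_trans yL)// lerDl mulr_ge0 ?powR_ge0.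
apply: (@le_trans _ _ (L `^ (1 - p) * y `^ p)); last by rewrite lerDr ltW.
have {}y0 : 0 < y := lt_trans L0 yL.
have E : y = y `^ (1 - p) * y `^ p.
  by rewrite -powRD ?subrK ?powRr1 ?oner_eq0// ltW.
rewrite [leLHS]E; apply: ler_wpM2r; first exact: powR_ge0.
rewrite -opprB !powRN lef_pV2 ?posrE ?powR_gt0//.
by apply: ge0_ler_powR; rewrite ?nnegrE ?subr_ge0// ltW.
Qed.

Lemma card_le_diff (R : realType) (n : nat) (P : pred nat) (L : R) :
  0 <= L ->
  (forall i j, (i < n)%N -> (j < n)%N -> P i -> P j -> i%:R - j%:R <= L) ->
  (\sum_(i < n) P i)%N%:R <= L + 1.
Proof.
move=> L0; elim: n => [|n IH] H; first by rewrite big_ord0; lra.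
have H' i j : (i < n)%N -> (j < n)%N -> P i -> P j -> i%:R - j%:R <= L.
  by move=> hi hj; apply: H; exact: ltnW.
rewrite big_ord_recr /=.
case Pn : (P n); last by rewrite addn0; exact: IH.
have E (j : 'I_n) : P j -> n%:R - j%:R <= L.
  by move=> Pj; apply: H => //; rewrite ltnS ltnW.
clear IH.
case: (pickP (fun j : 'I_n => P j)) => [j0 Pj0|P0]; last first.
  by rewrite big1 ?add0n /= => [|i _]; [lra|rewrite P0].
have exP : exists m, (m < n)%N && P m by exists j0; rewrite ltn_ord Pj0.

have [m /andP[mn Pm] mmin] := ex_minnP exP.
have -> : (\sum_(i < n) P i = \sum_(m <= i < n) P i)%N.
  rewrite -(big_mkord xpredT (fun i => P i : nat)).
  rewrite (big_cat_nat (n := m))//=; last exact: ltnW.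
  rewrite big_nat big1 ?add0n// => i /andP[_ im]; case Pi: (P i) => //.
  by have := mmin i; rewrite Pi (ltn_trans im mn) leqNgt im => /(_ isT).
apply: (@le_trans _ _ (n - m + 1)%:R).
  rewrite ler_nat leq_add2r.
  by rewrite -[leqRHS]muln1 -sum_nat_const_nat leq_sum// => i _; case: (P i).
by rewrite natrD (natrB _ (ltnW mn)) lerD2r; exact: (E (Ordinal mn)).
Qed.

(** A bound on all square partial sums thus controls any enumeration of the pairs; [K] exceeds every
    coordinate occurring in [F]. *)
Lemma sum_pairs_le (R : realType) (u : nat -> nat -> R) :
  (forall i j, 0 <= u i j) ->
  forall F : seq (nat * nat), uniq F ->
  exists K, \sum_(x <- F) u x.1 x.2 <= \sum_(i < K) \sum_(j < K) u i j.
Proof.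
move=> u0 F uF.
pose K := (\max_(x <- F) (maxn x.1 x.2)).+1.
exists K.
have FK x : x \in F -> (x.1 < K)%N /\ (x.2 < K)%N.
  move=> xF; have : (maxn x.1 x.2 <= \max_(x <- F) (maxn x.1 x.2))%N.
    exact: leq_bigmax_seq.
  by rewrite geq_max /K !ltnS => /andP[].
pose G := [seq (i, j) | i <- iota 0 K, j <- iota 0 K].
have -> : \sum_(i < K) \sum_(j < K) u i j = \sum_(x <- G) u x.1 x.2.
  rewrite big_allpairs_dep -(big_mkord xpredT (fun i => \sum_(j < K) u i j)).
  rewrite /index_iota subn0; apply: eq_bigr => i _.
  by rewrite -(big_mkord xpredT (u i)) /index_iota subn0.
have uG : uniq G.
  apply: allpairs_uniq; rewrite ?iota_uniq// => -[? ?] [? ?] _ _ /= [-> ->] //.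
rewrite [leRHS](bigID (fun x => x \in F))/= -[X in _ <= X + _]big_filter.
rewrite [X in _ <= X + _](@perm_big _ _ _ _ _ F); last first.
  apply: uniq_perm; [exact: filter_uniq|by []|].
  move=> [i j]; rewrite mem_filter; case xF: (_ \in F) => //=.
  have [iK jK] := FK _ xF.
  by apply: allpairs_f; rewrite mem_iota.
by rewrite lerDl sumr_ge0.
Qed.

(* For [s > 0] this is equivalent to the vanishing of the [s]-dimensional
   Hausdorff measure: the covering sets are small as soon as [e] is. *)
Definition hnull (R : realType) (s : R) (E : set R) : Prop :=
  forall e : R, 0 < e -> exists U : nat -> set R, exists u : nat -> R,
    [/\ E `<=` \bigcup_i U i, forall i, 0 <= u i,
      forall i x y, U i x -> U i y -> circle_dist x y `^ s <= u i &
      forall n, \sum_(i < n) u i <= e].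

Lemma sub_hnull (R : realType) (s : R) (E F : set R) :
  E `<=` F -> hnull s F -> hnull s E.
Proof.
move=> EF hF e e0; have [U [u [FU u0 d sum]]] := hF _ e0.
by exists U, u; split=> //; exact: subset_trans FU.
Qed.

(** Lets covers be indexed by scale and position, or by piece and cover. Integers that code no pair
    get the empty set at cost 0. *)
Lemma hnull_pairs (R : realType) (s : R) (E : set R) :
  (forall e : R, 0 < e ->
    exists U : nat -> nat -> set R, exists u : nat -> nat -> R,
    [/\ forall x, E x -> exists i j, U i j x, forall i j, 0 <= u i j,
      forall i j x y, U i j x -> U i j y -> circle_dist x y `^ s <= u i j &
      forall n, \sum_(i < n) \sum_(j < n) u i j <= e]) ->
  hnull s E.
Proof.
move=> H e e0; have [U [u [EU u0 d sum]]] := H _ e0.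
pose V (n : nat) := if pickle_inv n is Some (i, j) then U i j else set0.
pose v n := if pickle_inv n is Some (i, j) then u i j else 0.
exists V, v; split.
- move=> x /EU[i [j Ux]]; exists (pickle (i, j)) => //.
  by rewrite /V pickleK_inv.
- by move=> n; rewrite /v; case: pickle_inv => [[]|].
- move=> n x y; rewrite /V /v; case: pickle_inv => [[i j]|//]; exact: d.
- move=> n.
  have -> : \sum_(i < n) v i =
      \sum_(x <- pmap (@pickle_inv (nat * nat)%type) (iota 0 n)) u x.1 x.2.
    rewrite big_pmap -(big_mkord xpredT v) /index_iota subn0.
    rewrite [RHS]big_mkcond; apply: eq_bigr => i _.
    by rewrite /v /=; case: pickle_inv => [[]|].
  have /(sum_pairs_le u0)[K] :
      uniq (pmap (@pickle_inv (nat * nat)%type) (iota 0 n)).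
    by rewrite (pmap_uniq (@pickle_invK _))// iota_uniq.
  by move=> /le_trans; apply.
Qed.

Lemma sum_geo_lt (R : realType) (q : R) (n : nat) :
  0 <= q < 1 -> \sum_(i < n) q ^+ i <= (1 - q)^-1.
Proof.
move=> /andP[q0 q1]; have q1' : 0 < 1 - q by rewrite subr_gt0.
rewrite -[leRHS]mul1r ler_pdivlMr//.
have -> : (\sum_(i < n) q ^+ i) * (1 - q) = 1 - q ^+ n.
  by rewrite -opprB mulrN mulrC -subrX1 opprB.
by rewrite gerBl exprn_ge0.
Qed.

Lemma hnull_bigcup (R : realType) (s : R) (E : nat -> set R) :
  (forall n, hnull s (E n)) -> hnull s (\bigcup_n E n).
Proof.
move=> hE; apply: hnull_pairs => e e0.
have e2 n : 0 < e / 2 * 2^-1 ^+ n by rewrite mulr_gt0 ?exprn_gt0 //; lra.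
have /choice[U /choice[u Hu]] := fun n => hE n _ (e2 n).
exists U, u; split.
- by move=> x [i _ Ex]; have [+ _ _ _] := Hu i => /(_ _ Ex)[j _]; exists i, j.
- by move=> i; have [] := Hu i.
- by move=> i; have [] := Hu i.
- move=> n; apply: (@le_trans _ _ (\sum_(i < n) e / 2 * 2^-1 ^+ i)).
    by apply: ler_sum => i _; have [] := Hu i.
  rewrite -mulr_sumr; have := @sum_geo_lt _ (2^-1 : R) n.
  have -> : 1 - 2^-1 = 2^-1 :> R by lra.
  rewrite invrK => /(_ _); set S := \sum_(i < n) _.
  have -> : 0 <= (2^-1 : R) < 1 by lra.
  by move=> /(_ isT); nra.
Qed.

Lemma hnullU (R : realType) (s : R) (E F : set R) :
  hnull s E -> hnull s F -> hnull s (E `|` F).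
Proof.
move=> hE hF; have : hnull s (\bigcup_n (if n == 0%N then E else F)).
  by apply: hnull_bigcup => -[|n].
apply: sub_hnull => x [Ex|Fx]; first by exists 0%N.
by exists 1%N.
Qed.

Lemma circle_dist_ge0 (R : realType) (x y : R) : 0 <= circle_dist x y.
Proof.
rewrite /circle_dist le_min !subr_ge0 /=; set t := x - y.
have /andP[-> h] /= := floor_itv t.
by move: h; rewrite intrD1; lra.
Qed.

Lemma circle_dist_le (R : realType) (x y : R) : circle_dist x y <= `|x - y|.
Proof.
rewrite /circle_dist ge_min; set t := x - y.
have /andP[h1 h2] := floor_itv t; move: h2; rewrite intrD1 => h2.
case: (lerP 0 t) => t0; first by rewrite ger0_norm//; have := t0;
  rewrite -floor_ge0 -(ler0z R) => f0; apply/orP; left; lra.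
apply/orP; right; rewrite ltr0_norm//.
have : (Num.floor t)%:~R <= -1 :> R; last by lra.
by rewrite -[-1]/((-1)%:~R) ler_int; have := floor_lt0 t; rewrite t0; lia.
Qed.

Lemma circle_dist_small (R : realType) (x y : R) :
  `|x - y| <= 2^-1 -> circle_dist x y = `|x - y|.
Proof.
rewrite /circle_dist; set t := x - y => t2.
case: (lerP 0 t) => t0.
  have -> : Num.floor t = 0.
    by apply: floor_def; rewrite add0r t0/=; move: t2; rewrite ger0_norm//; lra.
  by rewrite subr0 ger0_norm// min_l//; move: t2; rewrite ger0_norm//; lra.
have -> : Num.floor t = -1.
  apply: floor_def; rewrite addNr t0 andbT; move: t2; rewrite ltr0_norm//.
  by rewrite mulrN1z; lra.
move: t2; rewrite ltr0_norm// mulrN1z opprK => t2.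
by rewrite min_r; lra.
Qed.

Lemma exprn_small (R : realType) (q e : R) :
  0 <= q < 1 -> 0 < e -> exists n, q ^+ n <= e.
Proof.
move=> /andP[q0 q1] e0.
have /cvg_expr : `|q| < 1 by rewrite ger0_norm.
move=> /cvgr0_norm_le /(_ _ e0)[n _ /(_ n (leqnn n))] /=.
by rewrite ger0_norm ?exprn_ge0//; exists n.
Qed.

Lemma le_diameter (R : realType) (U : set R) x y : U x -> U y ->
  ((circle_dist x y)%:E <= diameter (@circle_dist R) U)%E.
Proof.
by move=> Ux Uy; apply: ereal_sup_ubound; right; exists (x, y).
Qed.

Lemma diameter_le (R : realType) (U : set R) (d : R) : 0 <= d ->
  (forall x y, U x -> U y -> circle_dist x y <= d) ->
  (diameter (@circle_dist R) U <= d%:E)%E.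
Proof.
move=> d0 H; apply: ge_ereal_sup => _ [->|[[x y] [/= Ux Uy] <-]].
  by rewrite lee_fin.
by rewrite lee_fin; exact: H.
Qed.

Lemma diameter_ge0 (R : realType) (U : set R) :
  (0 <= diameter (@circle_dist R) U)%E.
Proof. by apply: ereal_sup_ubound; left. Qed.

Lemma le_powRV (R : realType) (s x y : R) :
  0 < s -> 0 <= x -> 0 <= y -> x `^ s <= y -> x <= y `^ s^-1.
Proof.
move=> s0 x0 y0 xy.
have -> : x = (x `^ s) `^ s^-1 by rewrite -powRrM mulfV ?gt_eqF// powRr1.
by apply: ge0_ler_powR; rewrite ?nnegrE ?powR_ge0// invr_ge0 ltW.
Qed.

Lemma hausdorff_measure_hnull (R : realType) (s : R) (E : set R) :
  0 < s -> hnull s E -> hausdorff_measure (@circle_dist R) s E = 0%E.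
Proof.
move=> s0 hE.
have content0 d : 0 < d -> hausdorff_content (@circle_dist R) s d E = 0%E.
  move=> d0; apply/eqP; rewrite eq_le; apply/andP; split; last first.
    apply: le_ereal_inf_tmp => _ [U _ <-]; apply: nneseries_ge0 => n _ _.
    exact: poweR_ge0.
  apply/lee_addgt0Pr => e e0; rewrite add0e.
  (* A total cost of at most d^s bounds each single [u i], hence each diameter by [d], since s >
     0. *)
  have me0 : 0 < Num.min e (d `^ s) by rewrite lt_min e0 powR_gt0.
  have [U [u [EU u0 dU sum]]] := hE _ me0.
  have ud i : u i <= d `^ s.
    apply: (@le_trans _ _ (\sum_(j < i.+1) u j)).
      by rewrite big_ord_recr /= lerDr sumr_ge0.
    by apply: le_trans (sum _) _; rewrite ge_min lexx orbT.
  have ss : s^-1 * s = 1 by rewrite mulVf ?gt_eqF.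
  have diamU i : (diameter (@circle_dist R) (U i) <= (u i `^ s^-1)%:E)%E.
    apply: diameter_le => [|x y Ux Uy]; first exact: powR_ge0.
    by apply: le_powRV; rewrite ?circle_dist_ge0//; exact: dU.
  apply: (@le_trans _ _ (\sum_(i <oo | U i != set0)
      diameter (@circle_dist R) (U i) `^ s)%E).
    apply: ereal_inf_lbound; exists U => //; split=> // i.
    apply: le_trans (diamU i) _.
    have -> : d = (d `^ s) `^ s^-1.
      by rewrite -powRrM mulfV ?gt_eqF// powRr1// ltW.
    rewrite lee_fin; apply: ge0_ler_powR; rewrite ?nnegrE ?powR_ge0 ?u0 //.
    by rewrite invr_ge0 ltW.
  apply: (@le_trans _ _ (\sum_(i <oo | U i != set0) (u i)%:E)%E).
    apply: lee_nneseries => [i _ _|i _]; first exact: poweR_ge0.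
    apply: (@le_trans _ _ ((u i `^ s^-1)%:E `^ s)%E).
      apply: gt0_ler_poweR => //; rewrite ?in_itv/= ?leey ?andbT//.
      - exact: ltW.
      - exact: diameter_ge0.
      - by rewrite lee_fin powR_ge0.
    by rewrite poweR_EFin -powRrM ss powRr1.
  apply: (@le_trans _ _ (\sum_(i <oo) (u i)%:E)%E).
    by apply: subset_lee_nneseries => // i _; rewrite lee_fin.
  apply: lime_le.
    by apply: is_cvg_ereal_nneg_natsum => i _; rewrite lee_fin.
  near=> n; rewrite sumEFin big_mkord lee_fin; apply: le_trans (sum _) _.
  by rewrite ge_min lexx.
rewrite /hausdorff_measure [X in ereal_sup X](_ : _ = [set 0%E]) ?ereal_sup1//.
apply/seteqP; split=> [_ [d /= d0 <-]|_ ->]; first exact: content0.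
by exists 1 => //=; exact: content0.
Unshelve. all: by end_near. Qed.

(** The scale 1 suffices: for diameters at most 1, raising the exponent from [s] to [s'] can only
    lower the cost. The case s = 0 is included because the infimum in [hausdorff_dim] ranges over
    it. *)
Lemma hnull_hausdorff_measure (R : realType) (s s' : R) (E : set R) :
  0 <= s -> s <= s' -> 0 < s' ->
  hausdorff_measure (@circle_dist R) s E = 0%E -> hnull s' E.
Proof.
move=> s0 ss' s'0 HE e e0.
have : (hausdorff_content (@circle_dist R) s 1 E < e%:E)%E.
  apply: (@le_lt_trans _ _ 0%E); last by rewrite lte_fin.
  by rewrite -HE; apply: ereal_sup_ubound; exists 1; rewrite //= ltr01.
move=> /ereal_inf_lt[_ [U [dU EU] <-] sum].
pose D i := diameter (@circle_dist R) (U i).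
have Dfin i : D i \is a fin_num.
  by rewrite ge0_fin_numE ?diameter_ge0// (le_lt_trans (dU i))// ltry.
pose u i := if U i != set0 then fine (D i) `^ s else 0.
have uE i : (u i)%:E = (if U i != set0 then D i `^ s else 0)%E.
  rewrite /u; case: ifPn => // _.
  by rewrite -[in RHS](fineK (Dfin i)) poweR_EFin.
have u0 i : 0 <= u i by rewrite /u; case: ifP => // _; exact: powR_ge0.
exists U, u; split=> //.
- move=> i x y Ux Uy.
  have dD : circle_dist x y <= fine (D i).
    by rewrite -lee_fin fineK// le_diameter.
  have D1 : fine (D i) <= 1 by rewrite -lee_fin fineK//; exact: dU.
  rewrite /u; case: ifPn => [_|/negP]; last first.
    by case; apply/set0P; exists x.
  have [->|d0] := eqVneq (circle_dist x y) 0.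
    by rewrite powR0 ?gt_eqF// powR_ge0.
  have {}d0 : 0 < circle_dist x y by rewrite lt0r d0 circle_dist_ge0.
  apply: (@le_trans _ _ (circle_dist x y `^ s)).
    by apply: ger_powR => //; rewrite d0 (le_trans dD D1).
  apply: ge0_ler_powR => //; rewrite nnegrE ?circle_dist_ge0//.
  exact: ltW (lt_le_trans d0 dD).
- move=> n; rewrite -lee_fin; apply: le_trans (ltW sum).
  rewrite -sumEFin -(big_mkord xpredT (fun i => (u i)%:E)).
  under eq_bigr do rewrite uE.
  rewrite -big_mkcond.
  by apply: nneseries_lim_ge => i _ _; exact: poweR_ge0.
Qed.

(** At generation i, at most C 2^(s i) dyadic intervals have mass at least 2^(-s i). Covering by
    them costs C 2^((s - s') i), which is summable, so the generations from [i0] on form a cheap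
    cover. *)
Lemma hnull_dyadic (R : realType) (s s' : R) (m : nat -> nat -> R) (C : R)
    (E : set R) :
  s < s' -> (forall i k, 0 <= m i k) -> (forall i n, \sum_(k < n) m i k <= C) ->
  0 <= s' ->
  (forall x, E x -> forall i0, exists i k, [/\ (i0 <= i)%N,
     k%:R <= x * 2 ^+ i < k%:R + 1 & 2 `^ (- s * i%:R) <= m i k]) ->
  hnull s' E.
Proof.
move=> ss' m0 mC s'0 HE; apply: hnull_pairs => e e0.
have C0 : 0 <= C by have := mC 0%N 0%N; rewrite big_ord0.
(* 2^((s - s') i) is split as r^i r^i: one factor is at most r^i0 and makes the cover cheap, the
   other sums to at most 1 / (1 - r). *)
pose r : R := 2 `^ ((s - s') / 2).
have r0 : 0 < r by rewrite powR_gt0.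
have r1 : r < 1.
  have -> : 1 = 2 `^ 0 :> R by rewrite powRr0.
  by apply: gt1_ltr_powR; lra.
have rr : 0 <= r < 1 by rewrite ltW.
have e1 : 0 < e * (1 - r) / (C + 1).
  by rewrite divr_gt0 ?mulr_gt0//; lra.
have [i0 hi0] := exprn_small rr e1.
pose ch i k := (i0 <= i)%N && (2 `^ (- s * i%:R) <= m i k).
exists (fun i k => [set x | ch i k && (k%:R <= x * 2 ^+ i < k%:R + 1)]).
pose u i k : R := if ch i k then 2 `^ (- s' * i%:R) else 0.
exists u; split.
- move=> x Ex; have [i [k [hi hk hm]]] := HE x Ex i0.
  by exists i, k; rewrite /= /ch hi hm hk.
- by move=> i k; rewrite /u; case: ifP => // _; exact: powR_ge0.
- move=> i k x y /= /andP[cik hx] /andP[_ hy]; rewrite /u cik.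
  have -> : 2 `^ (- s' * i%:R) = (2^-1 ^+ i) `^ s' :> R.
    rewrite -powR_mulrn// -powRrM -[2^-1]powR_inv1// -powRrM.
    by congr (_ `^ _); ring.
  apply: ge0_ler_powR => //; rewrite ?nnegrE ?circle_dist_ge0 ?exprn_ge0//.
  apply: le_trans (circle_dist_le _ _) _.
  have i2 : 0 < (2 : R) ^+ i by rewrite exprn_gt0.
  rewrite exprVn -(ler_pM2r i2) mulVf ?gt_eqF// -[X in _ * X]gtr0_norm//.
  by rewrite -normrM mulrBl ler_norml; lra.
- move=> n.
  have ul i k : u i k <= r ^+ i0 * r ^+ i * m i k.
    rewrite /u /ch; case: ifPn => [/andP[hi hm]|_]; last first.
      by rewrite !mulr_ge0 ?exprn_ge0// ltW.
    apply: (@le_trans _ _ (r ^+ i * r ^+ i * 2 `^ (- s * i%:R))).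
      rewrite -!powR_mulrn ?(ltW r0)// -!powRrM -!powRD; last 2 first.
      - by rewrite pnatr_eq0 implybT.
      - by rewrite pnatr_eq0 implybT.
      by rewrite le_eqVlt; apply/orP; left; apply/eqP; congr (_ `^ _); field.
    apply: ler_pM => //; rewrite ?mulr_ge0 ?exprn_ge0 ?powR_ge0 ?(ltW r0)//.
    apply: ler_wpM2r; first by rewrite exprn_ge0 // ltW.
    by apply: ler_wiXn2l => //; exact: ltW.
  apply: (@le_trans _ _ (\sum_(i < n) r ^+ i0 * r ^+ i * C)).
    apply: ler_sum => i _.
    apply: (@le_trans _ _ (\sum_(k < n) r ^+ i0 * r ^+ i * m i k)).
      by apply: ler_sum => k _; exact: ul.
    rewrite -mulr_sumr; apply: ler_wpM2l => //.
    by rewrite mulr_ge0 ?exprn_ge0// ltW.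
  rewrite -mulr_suml -mulr_sumr.
  apply: (@le_trans _ _ (e * (1 - r) / (C + 1) * (1 - r)^-1 * C)).
    apply: ler_wpM2r => //; apply: ler_pM => //.
    - by rewrite exprn_ge0// ltW.
    - by rewrite sumr_ge0// => i _; rewrite exprn_ge0// ltW.
    - exact: sum_geo_lt.
  have -> : e * (1 - r) / (C + 1) / (1 - r) * C = e * (C / (C + 1)).
    by field; apply/andP; split; lra.
  by rewrite ler_piMr ?(ltW e0)// ler_pdivrMr; lra.
Qed.

(** * Limsup sets that are not null *)

Section Cantor.
Context (R : realType).
Implicit Types (s r v y : R) (V : set R).

Let meets V y r : bool := `[< exists x, V x /\ y <= x <= y + r >].
(** Cost charged to an interval of length [r] by a covering set of budget [v] that it meets: a
    multiple of [v] relative to r^s, capped at 1. The factor 20 absorbs the counting losses in the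
    next lemma. *)
Let weight s r v : R := Num.min 1 (20 * v / r `^ s).

(** Let d = v^(1/s), which bounds the diameter of [V] inside the parent; then [V] meets at most (d +
    r) Q + 1 children. If d Q < 1/2 this is a single child, and rho^s <= N r^s. If d > rho, the cost
    at the parent is already the cap 1. Otherwise the count is at most 4 d Q <= 16 N d / rho, and d
    / rho <= v / rho^s because s <= 1. *)
Lemma cantor_children_cost s (rho r y v : R) (Q N k0 : nat) V :
  0 < s <= 1 -> 0 < v -> 0 < r -> 0 < rho -> (0 < Q)%N -> (0 < N)%N ->
  (forall x x', V x -> V x' -> y <= x <= y + rho -> y <= x' <= y + rho ->
    `|x - x'| `^ s <= v) ->
  (forall k, (k < N)%N ->
    y <= (k0 + k)%:R / Q%:R /\ (k0 + k)%:R / Q%:R + r <= y + rho) ->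
  rho * Q%:R <= 4 * N%:R -> 2 * r * Q%:R <= 1 ->
  4 * rho `^ s <= Q%:R * rho * r `^ s ->
  \sum_(k < N) (meets V ((k0 + k)%:R / Q%:R) r)%:R * weight s r v <=
  N%:R * ((meets V y rho)%:R * weight s rho v).
Proof.
move=> /andP[s0 s1] v0 r0 rho0 Q0 N0 dV sub hN hr hrho.
have Q0' : 0 < Q%:R :> R by rewrite ltr0n.
have N1 : 1 <= N%:R :> R by rewrite ler1n.
have rs0 : 0 < r `^ s by rewrite powR_gt0.
have rhos0 : 0 < rho `^ s by rewrite powR_gt0.
have incl k x : (k < N)%N ->
    (k0 + k)%:R / Q%:R <= x <= (k0 + k)%:R / Q%:R + r -> y <= x <= y + rho.
  move=> /sub[h1 h2] /andP[h3 h4].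
  by rewrite (le_trans h1 h3) (le_trans h4 h2).
have [my|nmy] := boolP (meets V y rho); last first.
  rewrite mul0r mulr0 big1// => k _.
  rewrite {1}/meets; case: asboolP => [[x [Vx hx]]|_].
    case/negP: nmy; apply/asboolP; exists x; split=> //.
    exact: incl hx.
  by rewrite mul0r.
rewrite mul1r -mulr_suml -natr_sum; set c : nat := \sum_(i < N) _.
have cN : c%:R <= N%:R :> R.
  rewrite ler_nat -[leqRHS]card_ord -sum1_card leq_sum// => i _.
  by case: (meets _ _ _).
have w0 : 0 <= weight s r v <= 1.
  by rewrite /weight le_min ler01 ge_min lexx /= divr_ge0 ?mulr_ge0// ltW.
set d := v `^ s^-1.
have d0 : 0 < d by rewrite powR_gt0.
have dv : d `^ s = v by rewrite -powRrM mulVf ?gt_eqF// powRr1// ltW.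
have cL : c%:R <= (d + r) * Q%:R + 1.
  have := @card_le_diff R N (fun k => meets V ((k0 + k)%:R / Q%:R) r)
    ((d + r) * Q%:R); apply.
    by rewrite mulr_ge0// ltW// addr_gt0.
  move=> i j hi hj /asboolP[x [Vx hx]] /asboolP[x' [Vx' hx']].
  have h := dV _ _ Vx Vx' (incl _ _ hi hx) (incl _ _ hj hx').
  have {}h : `|x - x'| <= d by apply: le_powRV => //; exact: ltW.
  rewrite -ler_pdivrMr//.
  have -> : (i%:R - j%:R) / Q%:R = (k0 + i)%:R / Q%:R - (k0 + j)%:R / Q%:R :> R.
    by rewrite !natrD; field; rewrite gt_eqF.
  move: h hx hx'; rewrite ler_norml; set a := _ / _; set b := _ / _; lra.
have -> : N%:R * weight s rho v =
    Num.min N%:R (N%:R * (20 * v / rho `^ s)).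
  by rewrite /weight minr_pMr// mulr1.
rewrite le_min.
have cwN : c%:R * weight s r v <= N%:R.
  by apply: (le_trans _ cN); rewrite ler_piMr//; case/andP: w0.
apply/andP; split=> //.
have [dQ|dQ] := ltrP (d * Q%:R) 2^-1.
  have c1 : c%:R <= 1 :> R.
    have : c%:R < 2 :> R by nra.
    by rewrite (ltr_nat R c 2) ltnS -(ler_nat R).
  apply: (@le_trans _ _ (20 * v / r `^ s)).
    apply: (@le_trans _ _ (weight s r v)).
      by rewrite ler_piMl//; case/andP: w0.
    by rewrite /weight ge_min lexx orbT.
  have : rho `^ s <= N%:R * r `^ s by nra.
  move=> h; rewrite ler_pdivrMr// -[leLHS]mulr1.
  have -> : N%:R * (20 * v / rho `^ s) * r `^ s =
     20 * v * (N%:R * r `^ s / rho `^ s) by ring.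
  by rewrite ler_pM2l ?mulr_gt0// ler_pdivlMr ?mul1r.
have [dr|dr] := lerP d rho; last first.
  apply: (le_trans cwN); rewrite ler_peMr ?(le_trans ler01 N1)//.
  rewrite ler_pdivlMr// mul1r -dv.
  have : rho `^ s <= d `^ s.
    by apply: ge0_ler_powR; rewrite ?nnegrE ltW.
  by have := powR_gt0 s d0; lra.
apply: (@le_trans _ _ c%:R); first by rewrite ler_piMr//; case/andP: w0.
apply: (@le_trans _ _ (16 * N%:R * (d / rho))).
  have : c%:R <= 4 * (d * Q%:R) by nra.
  move=> /le_trans; apply.
  by rewrite [leRHS]mulrA ler_pdivlMr//; nra.
have -> : N%:R * (20 * v / rho `^ s) = 20 * N%:R * (v / rho `^ s) by ring.
have : d / rho <= v / rho `^ s.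
  have <- : (d / rho) `^ s = v / rho `^ s.
    rewrite powRM ?invr_ge0 ?(ltW d0) ?(ltW rho0)// dv; congr (_ * _).
    by rewrite -(powR_inv1 (ltW rho0)) powRAC powR_inv1// powR_ge0.
  by apply: ger1_powR => //; rewrite divr_gt0//= ler_pdivrMr ?mul1r.
have : 0 < d / rho by rewrite divr_gt0.
by move: (d / rho) (v / rho `^ s) => p q; nra.
Qed.

(* The hypothesis [4 * rho `^ s <= Q * rho * r `^ s] says that splitting an
   interval of length [rho] into its [rho * Q / 4] children of length [r] does
   not decrease the [s]-dimensional size, so that the average over the children
   of the cost of a cover does not exceed the cost at the parent. *)
Lemma not_hnull_cantor s (A : nat -> set R) :
  0 < s <= 1 ->
  (forall n rho, 0 < rho <= 1 -> exists (Q : nat) (r : R),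
    [/\ (0 < Q)%N /\ 0 < r, 2 * r * Q%:R <= 1, 4 <= rho * Q%:R,
      4 * rho `^ s <= Q%:R * rho * r `^ s &
      forall (k : nat) (x : R), 4^-1 <= x <= 2^-1 ->
        k%:R / Q%:R <= x <= k%:R / Q%:R + r -> A n x]) ->
  ~ hnull s [set x | 4^-1 <= x <= 2^-1 /\ forall n, A n x].
Proof.
move=> s01 HA hE; have /andP[s0 s1] := s01.
(* The budgets [v] below sum to at most 2 e, so the cost at the initial interval [1/4, 1/2] is at
   most 20 (2 e) / (1/4)^s = 1/2. *)
have e0 : 0 < (4^-1 : R) `^ s / 80 by rewrite divr_gt0 ?powR_gt0// invr_gt0.
have {hE}[U [u [EU u0 dU sumu]]] := hE _ e0.
set e := _ / 80 in e0 sumu.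
(* The added geometric term makes every budget positive, so that [U j] charges the full weight 1 to
   all sufficiently short intervals that it meets. *)
pose v j : R := u j + e / 2 * 2^-1 ^+ j.
have v0 j : 0 < v j.
  by rewrite ltr_wpDl// mulr_gt0 ?exprn_gt0 ?divr_gt0 ?invr_gt0.
have sumv n : \sum_(j < n) v j <= 2 * e.
  rewrite big_split /= -mulr_sumr.
  have h2 : 0 <= (2^-1 : R) < 1 by lra.
  have := @sum_geo_lt R _ n h2; have -> : 1 - 2^-1 = 2^-1 :> R by lra.
  rewrite invrK; have := sumu n.
  by move: (\sum_(i < n) u i) (\sum_(i < n) _) => a b; nra.
pose cost n y rho := \sum_(j < n) (meets (U j) y rho)%:R * weight s rho (v j).
have w0 rho j : 0 < rho -> 0 <= weight s rho (v j).
  move=> rho0; rewrite /weight le_min ler01 divr_ge0 ?mulr_ge0 ?powR_ge0//.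
  exact: ltW.
have cost_le m n y rho : 0 < rho -> (m <= n)%N -> cost m y rho <= cost n y rho.
  move=> rho0 mn; rewrite /cost -!(big_mkord xpredT (fun j =>
    (meets (U j) y rho)%:R * weight s rho (v j))).
  rewrite (big_cat_nat (n := m) (p := n))//= lerDl sumr_ge0// => j _.
  by rewrite mulr_ge0// w0.
(* A state consists of a left end and a length. The bound 1/2 is uniform in the number of covering
   sets taken into account. *)
pose good (st : R * R) :=
  [/\ 4^-1 <= st.1, st.1 + st.2 <= 2^-1, 0 < st.2 &
     forall n, cost n st.1 st.2 <= 2^-1].
have step (n : nat) (st : R * R) : exists st' : R * R, good st ->
    [/\ good st', st.1 <= st'.1, st'.1 + st'.2 <= st.1 + st.2,
        st'.2 <= 2^-1 * st.2 &
        forall x, st'.1 <= x <= st'.1 + st'.2 -> A n x].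
  case: st => y rho; have [|ng] := pselect (good (y, rho)); last by exists (0, 0).
  move=> gst; case: (gst) => /= y4 yrho rho0 costy.
  have rho1 : 0 < rho <= 1 by rewrite rho0/=; lra.
  have [Q [r [[Q0 r0] rQ rhoQ hrho hA]]] := HA n rho rho1.
  have Q0' : 0 < Q%:R :> R by rewrite ltr0n.
  have yQ0 : 0 <= y * Q%:R by rewrite mulr_ge0//; lra.
  have rhoQ0 : 0 <= rho * Q%:R / 2 by lra.
  have := truncn_itv yQ0; set k0' := Num.trunc _ => /andP[k1 k2].
  have := truncn_itv rhoQ0; set N := Num.trunc _ => /andP[N1 N2].
  have N2' : rho * Q%:R <= 4 * N%:R by move: N2; rewrite -(natr1 N); lra.
  have N0 : (0 < N)%N by rewrite -(ltr_nat R); lra.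
  (* The children start at a multiple of 1 / Q beyond [y]; only about rho Q / 2 of them are kept,
     which leaves room for their length at the right end. *)
  pose k0 := k0'.+1.
  have sub k : (k < N)%N ->
      y <= (k0 + k)%:R / Q%:R /\ (k0 + k)%:R / Q%:R + r <= y + rho.
    rewrite -(ler_nat R) -natr1 => kN.
    have k0k : 0 <= k%:R :> R by [].
    split; first by rewrite ler_pdivlMr// natrD /k0; lra.
    rewrite -(ler_pM2r Q0') [leLHS]mulrDl mulfVK ?gt_eqF// natrD /k0 -(natr1 k0').
    by nra.
  have [/existsP[k /asboolP gk]|] := boolP [exists k : 'I_N,
      `[< good ((k0 + k)%:R / Q%:R, r) >]].
    have [h1 h2] := sub _ (ltn_ord k); case: (gk) => /= g1 g2 g3 g4.
    exists ((k0 + k)%:R / Q%:R, r) => _; split=> //=; first nra.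
    by move=> x hx; apply: (hA _ _ _ hx); move: hx; lra.
  rewrite negb_exists => /forallP nk; exfalso.
  (* If no child is good, each has cost above 1/2 for finitely many covering sets; a common number
     [m] of them contradicts the averaging of [cantor_children_cost]. *)
  have /choice[f hf] : forall k : 'I_N,
      exists m, 2^-1 < cost m ((k0 + k)%:R / Q%:R) r.
    move=> k; apply: contrapT => /forallNP H.
    have /asboolP := nk k; apply; have [h1 h2] := sub _ (ltn_ord k).
    split=> //=; [exact: le_trans h1|exact: le_trans yrho|].
    by move=> m; have /negP := H m; rewrite -leNgt.
  pose m := (\max_k f k)%N.
  have : N%:R * 2^-1 < \sum_(k < N) cost m ((k0 + k)%:R / Q%:R) r.
    have -> : N%:R * 2^-1 = \sum_(k < N) 2^-1 :> R.
      by rewrite sumr_const card_ord mulr_natl.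
    apply: ltr_sum.
      by apply/hasP; exists (Ordinal N0); rewrite ?mem_index_enum.
    move=> k _; apply: lt_le_trans (hf k) _.
    by apply: cost_le => //; exact: leq_bigmax.
  apply/negP; rewrite -leNgt exchange_big/=.
  apply: (@le_trans _ _ (N%:R * cost m y rho)); last by rewrite ler_wpM2l.
  rewrite /cost mulr_sumr; apply: ler_sum => j _.
  apply: cantor_children_cost => // x x' Ux Ux' hx hx'.
  rewrite -circle_dist_small; last by rewrite ler_norml; lra.
  apply: le_trans (dU _ _ _ Ux Ux') _.
  by rewrite lerDl mulr_ge0 ?exprn_ge0 ?divr_ge0 ?invr_ge0 // ltW.
have /choice[F hF] : forall p : nat * (R * R), exists st' : R * R, good p.2 ->
    [/\ good st', p.2.1 <= st'.1, st'.1 + st'.2 <= p.2.1 + p.2.2,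
        st'.2 <= 2^-1 * p.2.2 &
        forall x, st'.1 <= x <= st'.1 + st'.2 -> A p.1 x].
  by case=> n st; exact: step.
pose st := fix st n := if n is n'.+1 then F (n', st n') else (4^-1, 4^-1).
have good0 : good (st 0%N).
  split=> /=; [by []|lra|lra|move=> n].
  apply: (@le_trans _ _ (\sum_(j < n) (20 / 4^-1 `^ s) * v j)).
    apply: ler_sum => j _; apply: (@le_trans _ _ (weight s 4^-1 (v j))).
      by rewrite ler_piMl ?w0 ?invr_gt0//; case: (meets _ _ _).
    by rewrite /weight ge_min; apply/orP; right; rewrite mulrAC.
  rewrite -mulr_sumr; apply: (@le_trans _ _ (20 / 4^-1 `^ s * (2 * e))).
    by apply: ler_wpM2l => //; rewrite divr_ge0 ?powR_ge0.
  rewrite /e le_eqVlt; apply/orP; left; apply/eqP; field.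
  by rewrite gt_eqF// powR_gt0 ?invr_gt0.
have goodn n : good (st n).
  by elim: n => // n IH; have [] := hF (n, st n) IH.
have stepn n := hF (n, st n) (goodn n).
have mono m n : (m <= n)%N ->
    (st m).1 <= (st n).1 /\ (st n).1 + (st n).2 <= (st m).1 + (st m).2.
  elim: n => [|n IH]; first by rewrite leqn0 => /eqP ->.
  rewrite leq_eqVlt => /orP[/eqP->//|]; rewrite ltnS => /IH[h1 h2].
  have [_ h3 h4 _ _] := stepn n.
  by split; [exact: le_trans h3|exact: le_trans h2].
have rho_n n : (st n).2 <= 2^-1 ^+ n.
  elim: n => [|n IH]; first by rewrite expr0 /=; lra.
  have [_ _ _ h _] := stepn n; apply: le_trans h _.
  by rewrite exprS ler_pM2l ?invr_gt0.
pose S := [set (st n).1 | n in [set: nat]].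
have ubS n : ubound S ((st n).1 + (st n).2).
  move=> _ [m _ <-]; have [_ _ pm _] := goodn m; have [_ _ pn _] := goodn n.
  case: (leqP m n) => mn.
    by have [h _] := mono _ _ mn; lra.
  by have [_ h] := mono _ _ (ltnW mn); lra.
have S0 : S !=set0 by exists (st 0%N).1, 0%N.
pose x := sup S.
have hx n : (st n).1 <= x <= (st n).1 + (st n).2.
  apply/andP; split; last exact: ge_sup.
  by apply: ub_le_sup; [exists ((st 0%N).1 + (st 0%N).2)|exists n].
have [j _ Uj] : (\bigcup_i U i) x.
  apply: EU; split; first by have := hx 0%N; rewrite /=; lra.
  by move=> n; have [_ _ _ _] := stepn n; apply; exact: (hx n.+1).
(* Once the length of the interval is at most (20 v j)^(1/s), the set [U j] alone costs 1, above the
   bound 1/2. *)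
have q0 : 0 < (20 * v j) `^ s^-1 by rewrite powR_gt0// mulr_gt0.
have h2 : 0 <= (2^-1 : R) < 1 by lra.
have [n hn] := exprn_small h2 q0.
have [_ _ pn /(_ j.+1)] := goodn n.
apply/negP; rewrite -ltNge /cost big_ord_recr/=.
have -> : meets (U j) (st n).1 (st n).2.
  by apply/asboolP; exists x.
have -> : weight s (st n).2 (v j) = 1.
  apply/min_idPl; rewrite ler_pdivlMr ?powR_gt0// mul1r.
  apply: (@le_trans _ _ (((20 * v j) `^ s^-1) `^ s)).
    apply: ge0_ler_powR; rewrite ?nnegrE ?powR_ge0 ?(ltW pn) ?(ltW s0)//.
    exact: le_trans hn.
  by rewrite -powRrM mulVf ?gt_eqF// powRr1// mulr_ge0// ltW.
rewrite mul1r ltr_wpDl//; last by lra.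
by apply: sumr_ge0 => i _; rewrite mulr_ge0// w0.
Qed.

End Cantor.

Local Open Scope complex_scope.

(** * Integration on the circle *)

Section CircleIntegral.
Context (R : realType).
Let mu := @circle_measure R.
Implicit Types (f g : measurableTypeR R -> R).

Definition integ f := mu.-integrable setT (EFin \o f).

Lemma circle_measureT : mu setT = 1%E.
Proof.
rewrite /mu /= /mrestr setTI /circle.
by rewrite lebesgue_measure_itv /= lte_fin ltr01 -EFinD subr0.
Qed.

Lemma integ_cst (c : R) : integ (fun _ => c).
Proof.
apply: measurable_bounded_integrable => //.
  by rewrite circle_measureT ltry.
exists `|c|; split; first exact: normr_real.
by move=> M cM t _ /=; exact: ltW.
Qed.

Lemma integD f g : integ f -> integ g -> integ (fun t => f t + g t).
Proof. by move=> hf hg; exact: integrableD hf hg. Qed.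

Lemma integZ (c : R) f : integ f -> integ (fun t => c * f t).
Proof. by move=> hf; exact: integrableZl hf. Qed.

Lemma integ_sum (I : Type) (s : seq I) (F : I -> measurableTypeR R -> R) :
  (forall i, integ (F i)) -> integ (fun t => \sum_(i <- s) F i t).
Proof.
move=> hF; elim: s => [|i s IH].
  by under eq_fun do rewrite big_nil; exact: integ_cst.
under eq_fun do rewrite big_cons; exact: integD.
Qed.

Lemma integ_le f g : measurable_fun setT f -> (forall t, `|f t| <= g t) ->
  integ g -> integ f.
Proof.
move=> mf fg; apply: le_integrable => //; first exact/measurable_EFinP.
by move=> t _; rewrite lee_fin (le_trans (fg t))// ler_norm.
Qed.

Lemma integ_measurable f : integ f -> measurable_fun setT f.
Proof. by move=> /measurable_int /measurable_EFinP. Qed.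

Lemma intD f g : integ f -> integ g ->
  \int[mu]_t (f t + g t) = \int[mu]_t f t + \int[mu]_t g t.
Proof. exact: RintegralD. Qed.

Lemma intZ (c : R) f : integ f -> \int[mu]_t (c * f t) = c * \int[mu]_t f t.
Proof. by move=> hf; exact: RintegralZl. Qed.

Lemma int_le f g : integ f -> integ g -> (forall t, f t <= g t) ->
  \int[mu]_t f t <= \int[mu]_t g t.
Proof. by move=> hf hg fg; apply: le_Rintegral. Qed.

Lemma int_sum (I : Type) (s : seq I) (F : I -> measurableTypeR R -> R) :
  (forall i, integ (F i)) ->
  \int[mu]_t (\sum_(i <- s) F i t) = \sum_(i <- s) \int[mu]_t F i t.
Proof.
move=> hF; elim: s => [|i s IH].
  under eq_Rintegral do rewrite big_nil.
  by rewrite big_nil Rintegral_cst// mul0r.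
under eq_Rintegral do rewrite big_cons.
by rewrite big_cons intD ?IH//; exact: integ_sum.
Qed.

Lemma int_cst (c : R) : \int[mu]_t c = c.
Proof. by rewrite Rintegral_cst// circle_measureT mulr1. Qed.

Lemma int_circle f : integ f -> \int[mu]_t f t = \int[mu]_(t in @circle R) f t.
Proof.
move=> hf; rewrite /Rintegral; congr fine.
have mC := @measurable_circle R.
rewrite (negligible_integral (measurableC mC) measurableT hf); last first.
  by rewrite /mu /= /mrestr setICl measure0.
by rewrite setDE setTI setCK.
Qed.

Lemma int_lebesgueE f : integ f ->
  \int[mu]_t f t = \int[@lebesgue_measure R]_(t in `[0, 1]) f t.
Proof.
move=> hf; rewrite int_circle// /Rintegral; congr fine.
rewrite (@eq_measure_integral _ _ _ _ (@lebesgue_measure R))//; last first.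
  by move=> A mA AC; rewrite /mu /= /mrestr; congr (_ _); apply/setIidl.
rewrite /circle integral_itv_bndo_bndc//.
by apply/measurable_EFinP; apply: measurable_funTS; exact: integ_measurable.
Qed.

Lemma int_indic_le (a b : R) : a <= b ->
  \int[mu]_t (\1_(`[a, b]%classic : set (measurableTypeR R)) t : R) <= b - a.
Proof.
move=> ab; rewrite /Rintegral integral_indic// setIT /= /mrestr.
have h : (@lebesgue_measure R (`[a, b] `&` @circle R) <= (b - a)%:E)%E.
  apply: (@le_trans _ _ (@lebesgue_measure R `[a, b]%classic)).
    apply: le_measure; rewrite ?inE; last by move=> x [].
      by apply: measurableI; [exact: measurable_itv|exact: measurable_circle].
    exact: measurable_itv.
  by rewrite lebesgue_measure_itv /=; case: ifP => //= _; rewrite lee_fin subr_ge0.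
rewrite -lee_fin fineK// ge0_fin_numE ?measure_ge0//.
exact: (le_lt_trans h (ltry _)).
Qed.

Lemma integ_indic (A : set (measurableTypeR R)) : measurable A -> integ (\1_A).
Proof.
move=> mA; apply: (@integ_le _ (fun=> 1)); [exact: measurable_indic| |exact: integ_cst].
by move=> t; rewrite indicE; case: (_ \in _); rewrite ?normr1 ?normr0.
Qed.

End CircleIntegral.

Section ComplexIntegral.
Context (R : realType).
Let mu := @circle_measure R.
Implicit Types (f g : measurableTypeR R -> R[i]) (z : R[i]).

Lemma ReD (x y : R[i]) : complex.Re (x + y) = complex.Re x + complex.Re y.
Proof. by case: x; case: y. Qed.

Lemma ImD (x y : R[i]) : complex.Im (x + y) = complex.Im x + complex.Im y.
Proof. by case: x; case: y. Qed.

Lemma ReM (x y : R[i]) : complex.Re (x * y) =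
  complex.Re x * complex.Re y - complex.Im x * complex.Im y.
Proof. by case: x; case: y. Qed.

Lemma ImM (x y : R[i]) : complex.Im (x * y) =
  complex.Re x * complex.Im y + complex.Im x * complex.Re y.
Proof. by case: x; case: y. Qed.

Lemma complex_ext (x y : R[i]) : complex.Re x = complex.Re y ->
  complex.Im x = complex.Im y -> x = y.
Proof. by case: x; case: y => a b c d /= -> ->. Qed.

Lemma sqr_normc (z : R[i]) :
  normc z ^+ 2 = complex.Re z ^+ 2 + complex.Im z ^+ 2.
Proof. by case: z => a b /=; rewrite sqr_sqrtr// addr_ge0 ?sqr_ge0. Qed.

Lemma normr_Re_le (z : R[i]) : `|complex.Re z| <= normc z.
Proof.
rewrite -(@ler_pXn2r _ 2)// ?nnegrE ?normc_ge0// sqr_normc real_normK ?num_real//.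
by rewrite lerDl sqr_ge0.
Qed.

Lemma normr_Im_le (z : R[i]) : `|complex.Im z| <= normc z.
Proof.
rewrite -(@ler_pXn2r _ 2)// ?nnegrE ?normc_ge0// sqr_normc real_normK ?num_real//.
by rewrite lerDr sqr_ge0.
Qed.

Lemma normc_leD (z : R[i]) : normc z <= `|complex.Re z| + `|complex.Im z|.
Proof.
rewrite -(@ler_pXn2r _ 2)// ?nnegrE ?normc_ge0 ?addr_ge0// sqr_normc.
rewrite sqrrD !real_normK ?num_real// lerD2r lerDl.
by rewrite mulrn_wge0// mulr_ge0.
Qed.

Lemma normc_sum_le (I : Type) (s : seq I) (F : I -> R[i]) :
  normc (\sum_(i <- s) F i) <= \sum_(i <- s) normc (F i).
Proof.
elim: s => [|i s IH]; first by rewrite !big_nil normc0.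
by rewrite !big_cons (le_trans (ler_normcD _ _))// lerD2l.
Qed.

Lemma normc_real (a : R) : normc a%:C = `|a|.
Proof. by rewrite /= expr0n /= addr0 sqrtr_sqr. Qed.

Definition cmeas f :=
  measurable_fun setT (@complex.Re R \o f) /\
  measurable_fun setT (@complex.Im R \o f).

Lemma cmeas_cst z : cmeas (fun=> z).
Proof. by split; exact: measurable_cst. Qed.

Lemma cmeasD f g : cmeas f -> cmeas g -> cmeas (fun t => f t + g t).
Proof.
move=> [f1 f2] [g1 g2]; split.
  rewrite [X in measurable_fun _ X](_ : _ = fun t =>
    complex.Re (f t) + complex.Re (g t)); first exact: measurable_funD.
  by apply/funext => t; exact: ReD.
rewrite [X in measurable_fun _ X](_ : _ = fun t =>
  complex.Im (f t) + complex.Im (g t)); first exact: measurable_funD.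
by apply/funext => t; exact: ImD.
Qed.

Lemma cmeasM f g : cmeas f -> cmeas g -> cmeas (fun t => f t * g t).
Proof.
move=> [f1 f2] [g1 g2]; split.
  rewrite [X in measurable_fun _ X](_ : _ = fun t =>
    complex.Re (f t) * complex.Re (g t) - complex.Im (f t) * complex.Im (g t)).
    by apply: measurable_funB; exact: measurable_funM.
  by apply/funext => t; exact: ReM.
rewrite [X in measurable_fun _ X](_ : _ = fun t =>
  complex.Re (f t) * complex.Im (g t) + complex.Im (f t) * complex.Re (g t)).
  by apply: measurable_funD; exact: measurable_funM.
by apply/funext => t; exact: ImM.
Qed.

Lemma cmeas_sum (I : Type) (s : seq I) (F : I -> measurableTypeR R -> R[i]) :
  (forall i, cmeas (F i)) -> cmeas (fun t => \sum_(i <- s) F i t).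
Proof.
move=> hF; elim: s => [|i s IH].
  by under eq_fun do rewrite big_nil; exact: cmeas_cst.
by under eq_fun do rewrite big_cons; exact: cmeasD.
Qed.

Lemma cmeas_normc f : cmeas f -> measurable_fun setT (@normc R \o f).
Proof.
move=> [f1 f2].
have -> : @normc R \o f = (fun t => Num.sqrt
   ((complex.Re (f t)) ^+ 2 + (complex.Im (f t)) ^+ 2)).
  by apply/funext => t /=; case: (f t).
apply: (@measurableT_comp _ _ _ _ _ _ (@Num.sqrt R)).
  apply: continuous_measurable_fun; exact: sqrt_continuous.
by apply: measurable_funD; exact: measurable_funX.
Qed.

Lemma measurable_normc_powR f (p : R) : cmeas f ->
  measurable_fun setT (fun t => normc (f t) `^ p).
Proof.
move=> mf; apply: (@measurableT_comp _ _ _ _ _ _ (fun x : R => x `^ p)) => //.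
exact: cmeas_normc.
Qed.

Lemma measurable_normc_gt f (r : R) : cmeas f ->
  measurable ([set t | r < normc (f t)] : set (measurableTypeR R)).
Proof.
move=> /cmeas_normc mf.
have := mf measurableT `]r, +oo[%classic (measurable_itv _).
rewrite setTI; congr measurable; apply/seteqP.
by split=> t; rewrite /= in_itv /= andbT.
Qed.

Definition cinteg f := cmeas f /\ integ (@normc R \o f).

Lemma cinteg_Re f : cinteg f -> integ (@complex.Re R \o f).
Proof.
move=> [[f1 _] f2]; apply: integ_le f2 => // t; exact: normr_Re_le.
Qed.

Lemma cinteg_Im f : cinteg f -> integ (@complex.Im R \o f).
Proof.
move=> [[_ f1] f2]; apply: integ_le f2 => // t; exact: normr_Im_le.
Qed.

Lemma cinteg_bounded f (B : R) : cmeas f -> (forall t, normc (f t) <= B) ->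
  cinteg f.
Proof.
move=> mf fB; split=> //; apply: (integ_le _ _ (integ_cst B)).
  exact: cmeas_normc.
by move=> t /=; rewrite ger0_norm ?normc_ge0.
Qed.

Lemma cintegD f g : cinteg f -> cinteg g -> cinteg (fun t => f t + g t).
Proof.
move=> [mf hf] [mg hg]; split; first exact: cmeasD.
apply: (integ_le _ _ (integD hf hg)); first by apply: cmeas_normc; exact: cmeasD.
by move=> t /=; rewrite ger0_norm ?normc_ge0// ler_normcD.
Qed.

Lemma cintegM f g (B : R) : cinteg f -> cmeas g -> (forall t, normc (g t) <= B) ->
  cinteg (fun t => f t * g t).
Proof.
move=> [mf hf] mg gB; split; first exact: cmeasM.
apply: (integ_le _ _ (integZ B hf)); first by apply: cmeas_normc; exact: cmeasM.
move=> t /=; rewrite ger0_norm ?normc_ge0// normcM mulrC.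
by rewrite ler_wpM2r ?normc_ge0.
Qed.

Lemma cintegZ z f : cinteg f -> cinteg (fun t => z * f t).
Proof.
move=> hf; have := cintegM hf (cmeas_cst z) (fun=> lexx _).
by under eq_fun do rewrite mulrC.
Qed.

Lemma cinteg_sum (I : Type) (s : seq I) (F : I -> measurableTypeR R -> R[i]) :
  (forall i, cinteg (F i)) -> cinteg (fun t => \sum_(i <- s) F i t).
Proof.
move=> hF; elim: s => [|i s IH].
  under eq_fun do rewrite big_nil.
  by apply: (@cinteg_bounded _ 0); [exact: cmeas_cst|rewrite normc0].
by under eq_fun do rewrite big_cons; exact: cintegD.
Qed.

Lemma CintegralD f g : cinteg f -> cinteg g ->
  Cintegral (fun t => f t + g t) = Cintegral f + Cintegral g.
Proof.
move=> hf hg; rewrite /Cintegral; apply: complex_ext => /=.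
  by rewrite -intD; [|exact: cinteg_Re|exact: cinteg_Re];
    apply: eq_Rintegral => t _ /=; rewrite ReD.
by rewrite -intD; [|exact: cinteg_Im|exact: cinteg_Im];
    apply: eq_Rintegral => t _ /=; rewrite ImD.
Qed.

Lemma CintegralZ z f : cinteg f ->
  Cintegral (fun t => z * f t) = z * Cintegral f.
Proof.
move=> hf; rewrite /Cintegral.
have hR := cinteg_Re hf; have hI := cinteg_Im hf.
apply: complex_ext.
  rewrite ReM /= -mulNr -!intZ// -intD; [|exact: integZ|exact: integZ].
  by apply: eq_Rintegral => t _ /=; rewrite ReM mulNr.
rewrite ImM /= -!intZ// -intD; [|exact: integZ|exact: integZ].
by apply: eq_Rintegral => t _ /=; rewrite ImM.
Qed.

Lemma Cintegral_sum (I : Type) (s : seq I) (F : I -> measurableTypeR R -> R[i]) :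
  (forall i, cinteg (F i)) ->
  Cintegral (fun t => \sum_(i <- s) F i t) = \sum_(i <- s) Cintegral (F i).
Proof.
move=> hF; elim: s => [|i s IH].
  under [X in Cintegral X]eq_fun do rewrite big_nil.
  by rewrite big_nil /Cintegral /= !Rintegral_cst// !mul0r.
under [X in Cintegral X]eq_fun do rewrite big_cons.
by rewrite big_cons CintegralD ?IH//; exact: cinteg_sum.
Qed.

(** The constant 2 comes from treating the real and imaginary parts separately. *)
Lemma normc_Cintegral_le f : cinteg f ->
  normc (Cintegral f) <= 2 * \int[mu]_t normc (f t).
Proof.
move=> hf; apply: le_trans (normc_leD _) _; rewrite /Cintegral mulrDl !mul1r.
have hR := cinteg_Re hf; have hI := cinteg_Im hf.
have [_ hn] := hf.
have nR : integ (fun t => `|complex.Re (f t)|) by exact: integrable_norm.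
have nI : integ (fun t => `|complex.Im (f t)|) by exact: integrable_norm.
apply: lerD.
  apply: (@le_trans _ _ (\int[mu]_t `|complex.Re (f t)|)).
    exact: le_normr_Rintegral.
  by apply: int_le => // t; exact: normr_Re_le.
apply: (@le_trans _ _ (\int[mu]_t `|complex.Im (f t)|)).
  exact: le_normr_Rintegral.
by apply: int_le => // t; exact: normr_Im_le.
Qed.

End ComplexIntegral.

(** * Partial sums and the Dirichlet kernel *)

Section DirichletKernel.
Context (R : realType).
Let mu := @circle_measure R.
Local Notation fe := (@fourier_exp R).
Implicit Types (k l : int) (t u x : R) (n : nat).

Lemma fourier_expD k t u : fe k (t + u) = fe k t * fe k u.
Proof.
rewrite /fourier_exp mulrDr cosD sinD; apply: complex_ext; first by rewrite ReM.
by rewrite ImM /= addrC.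
Qed.

Lemma fourier_expDl k l t : fe (k + l) t = fe k t * fe l t.
Proof.
rewrite /fourier_exp intrD mulrDr mulrDl cosD sinD.
by apply: complex_ext; [rewrite ReM|rewrite ImM /= addrC].
Qed.

Lemma fourier_exp0 t : fe 0 t = 1.
Proof. by rewrite /fourier_exp mulr0 mul0r cos0 sin0. Qed.

Lemma fourier_expN k t : fe (- k) t = (fe k t)^*.
Proof. by rewrite /fourier_exp intrN mulrN mulNr cosN sinN. Qed.

Lemma fourier_expNt k t : fe k (- t) = (fe k t)^*.
Proof. by rewrite /fourier_exp mulrN cosN sinN. Qed.

Lemma normc_fourier_exp k t : normc (fe k t) = 1.
Proof. by rewrite /= cos2Dsin2 sqrtr1. Qed.

(** Frequencies divisible by [Q] have period 1 / Q; this repeats a spike at every multiple of 1 /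
    Q. *)
Lemma fourier_exp_period (m : int) (k Q : nat) : (0 < Q)%N ->
  fe (m * Q%:Z) (k%:R / Q%:R) = 1.
Proof.
move=> Q0; elim: k => [|k IH].
  by rewrite mul0r /fourier_exp mulr0 cos0 sin0.
rewrite -natr1 mulrDl fourier_expD IH mul1r /fourier_exp.
have -> : 2 * trigo.pi * (m * Q%:Z)%:~R * (1 / Q%:R) = (trigo.pi *+ 2) *~ m :> R.
  rewrite intrM -[in LHS]pmulrn -[RHS]mulrzr -mulr_natl; field.
  by rewrite pnatr_eq0 -lt0n.
have H n : cos ((trigo.pi *+ 2) *+ n) = 1 :> R /\ sin ((trigo.pi *+ 2) *+ n) = 0 :> R.
  have /= c := periodicn (@cosD2pi R) n 0; have /= s := periodicn (@sinD2pi R) n 0.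
  by rewrite -[_ *+ n]add0r c s cos0 sin0.
case: m {IH} => n.
  by rewrite -pmulrn; have [-> ->] := H n.
by rewrite NegzE mulrNz -pmulrn cosN sinN; have [-> ->] := H n.+1; rewrite oppr0.
Qed.

Lemma cmeas_fourier_exp k x : cmeas (fun t => fe k (x - t)).
Proof.
have m1 (u : R -> R) : continuous u -> measurable_fun setT
    (fun t : measurableTypeR R => u (2 * trigo.pi * k%:~R * (x - t))).
  move=> cu; apply: (@measurableT_comp _ _ _ _ _ _ u).
    exact: continuous_measurable_fun.
  by apply: measurable_funM => //; apply: measurable_funB.
by split; apply: m1; [exact: continuous_cos|exact: continuous_sin].
Qed.

Lemma cmeas_fourier_exp0 k : cmeas (fe k).
Proof.
have := cmeas_fourier_exp (- k) 0; congr cmeas.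
by apply/funext => t; rewrite sub0r fourier_expN fourier_expNt conjcK.
Qed.

Definition kernel n u : R[i] := \sum_(i < n.*2.+1) fe (i%:Z - n%:Z) u.

Lemma cmeas_kernel n x : cmeas (fun t => kernel n (x - t)).
Proof. by apply: cmeas_sum => i; exact: cmeas_fourier_exp. Qed.

Lemma normc_kernel_le n u : normc (kernel n u) <= n.*2.+1%:R.
Proof.
apply: le_trans (normc_sum_le _ _) _.
rewrite (eq_bigr (fun=> 1)) ?sumr_const ?card_ord//.
by move=> i _; rewrite normc_fourier_exp.
Qed.

Lemma fourier_sumE n (f : measurableTypeR R -> R[i]) x : cinteg f ->
  fourier_sum n f x = Cintegral (fun t => f t * kernel n (x - t)).
Proof.
move=> hf; rewrite /fourier_sum /kernel.
have -> : (fun t => f t * (\sum_(i < n.*2.+1) fe (i%:Z - n%:Z) (x - t))) =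
   (fun t => \sum_(i < n.*2.+1) fe (i%:Z - n%:Z) x *
      (f t * (fe (i%:Z - n%:Z) t)^*)).
  apply/funext => t; rewrite mulr_sumr; apply: eq_bigr => i _.
  by rewrite fourier_expD fourier_expNt mulrCA.
have H k : cinteg (fun t => f t * (fe k t)^*).
  apply: (@cintegM _ _ _ 1) => //.
    have := cmeas_fourier_exp0 (- k); congr cmeas.
    by apply/funext => t; rewrite fourier_expN.
  by move=> t; rewrite -(normc_fourier_exp (- k) t) fourier_expN.
rewrite Cintegral_sum; last by move=> i; apply: cintegZ.
by apply: eq_bigr => i _; rewrite CintegralZ// mulrC.
Qed.

Lemma normc_fourier_sum_le n (f : measurableTypeR R -> R[i]) x : cinteg f ->
  normc (fourier_sum n f x) <=
  2 * \int[mu]_t (normc (f t) * normc (kernel n (x - t))).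
Proof.
move=> hf; rewrite fourier_sumE//.
apply: le_trans (normc_Cintegral_le _) _; last first.
  by under eq_Rintegral do rewrite normcM.
exact: (cintegM hf (cmeas_kernel n x) (fun t => normc_kernel_le n (x - t))).
Qed.

(** Crude, but uniform in [x]: it gives the exponent 1 for the divergence index and the stability of
    partial sums under perturbation in L^p. *)
Lemma normc_fourier_sum_le_int n (f : measurableTypeR R -> R[i]) x : cinteg f ->
  normc (fourier_sum n f x) <= 2 * (n.*2.+1%:R * \int[mu]_t normc (f t)).
Proof.
move=> hf; apply: le_trans (normc_fourier_sum_le _ _ hf) _.
rewrite ler_pM2l// -intZ; last exact: hf.2.
apply: int_le.
- have := (cintegM hf (cmeas_kernel n x)
    (fun t => normc_kernel_le n (x - t))).2.
  by congr integ; apply/funext => t /=; rewrite normcM.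
- by apply: integZ; exact: hf.2.
by move=> t; rewrite mulrC ler_wpM2r ?normc_ge0// normc_kernel_le.
Qed.

Lemma fourier_sumD n (f g : measurableTypeR R -> R[i]) x :
  cinteg f -> cinteg g ->
  fourier_sum n (fun t => f t + g t) x = fourier_sum n f x + fourier_sum n g x.
Proof.
move=> hf hg; rewrite !fourier_sumE//; last exact: cintegD.
rewrite -CintegralD; last 2 first.
- exact: (cintegM hf (cmeas_kernel n x) (fun t => normc_kernel_le n (x - t))).
- exact: (cintegM hg (cmeas_kernel n x) (fun t => normc_kernel_le n (x - t))).
by congr Cintegral; apply/funext => t; rewrite mulrDl.
Qed.

Lemma fourier_sumZ n z (f : measurableTypeR R -> R[i]) x : cinteg f ->
  fourier_sum n (fun t => z * f t) x = z * fourier_sum n f x.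
Proof.
move=> hf; rewrite !fourier_sumE//; last exact: cintegZ.
rewrite -CintegralZ; last first.
  exact: (cintegM hf (cmeas_kernel n x) (fun t => normc_kernel_le n (x - t))).
by congr Cintegral; apply/funext => t; rewrite mulrA.
Qed.

Lemma kernel_geometric n u :
  kernel n u * (fe 1 u - 1) = fe (n.+1)%:Z u - fe (- n%:Z) u.
Proof.
rewrite /kernel mulr_suml.
rewrite (eq_bigr (fun i : 'I_ _ => fe (i.+1%:Z - n%:Z) u - fe (i%:Z - n%:Z) u)).
  rewrite -(big_mkord xpredT
    (fun i : nat => fe (i.+1%:Z - n%:Z) u - fe (i%:Z - n%:Z) u)).
  rewrite telescope_sumr//; congr (fe _ u - fe _ u); lia.
move=> i _; rewrite mulrBr mulr1 -fourier_expDl; congr (fe _ u - _); lia.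
Qed.

Lemma normc_fourier_exp1B u : normc (fe 1 u - 1) = 2 * `|sin (trigo.pi * u)|.
Proof.
suff h : normc (fe 1 u - 1) ^+ 2 = (2 * `|sin (trigo.pi * u)|) ^+ 2.
  by apply: (pexpIrn (isT : (0 < 2)%N)) h; rewrite nnegrE ?mulr_ge0 ?normc_ge0.
rewrite sqr_normc.
have -> : fe 1 u = cos ((trigo.pi * u) *+ 2) +i* sin ((trigo.pi * u) *+ 2).
  by rewrite /fourier_exp mulr1 -mulrA mulr_natl.
rewrite cos_mulr2n sin_mulr2n /= exprMn real_normK ?num_real//.
have := cos2Dsin2 (trigo.pi * u).
move: (cos _) (sin _) => c s h.
have {h}hc : c ^+ 2 = 1 - s ^+ 2 by rewrite -h addrK.
apply: (@etrans _ _ ((2 * c ^+ 2 - 2) ^+ 2 + 4 * c ^+ 2 * s ^+ 2)); first by ring.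
by rewrite hc; ring.
Qed.

Lemma sin_lower_bound (eta : R) : 0 < eta <= 2^-1 ->
  exists c : R, 0 < c /\ forall y, 0 <= y <= (1 - eta) * trigo.pi -> c * y <= sin y.
Proof.
move=> /andP[eta0 eta1].
have pi2 := @pi_ge2 R; have pi4 := @pihalf_lt2 R.
have c1 := @cos1_gt0 R.
have hh : 1 <= trigo.pi / 2 :> R by lra.
have s1 : 0 < sin 1 :> R by apply: sin2_gt0; lra.
have seta : 0 < sin (eta * trigo.pi) by apply: sin_gt0_pi; nra.
(* Three ranges: on [0, 1] the mean value theorem gives slope at least cos 1; on [1, pi / 2] and
   beyond, sine is at least sin 1, respectively sin (eta pi), while y <= 4. *)
pose c := Num.min (cos 1) (Num.min (sin 1) (sin (eta * trigo.pi)) / 4).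
have c_1 : c <= cos 1 by rewrite /c ge_min lexx.
have c_2 : c <= sin 1 / 4.
  by rewrite /c ge_min; apply/orP; right; rewrite ler_pM2r// ge_min lexx.
have c_3 : c <= sin (eta * trigo.pi) / 4.
  by rewrite /c ge_min; apply/orP; right; rewrite ler_pM2r// ge_min lexx orbT.
have c0 : 0 < c by rewrite /c lt_min c1 divr_gt0// lt_min s1.
exists c; split=> // y /andP[y0 y1].
have y4 : y <= 4 by nra.
have [y_1|y_1] := lerP y 1.
  have [->|yn0] := eqVneq y 0; first by rewrite mulr0 sin0.
  have {}y0 : 0 < y by rewrite lt0r yn0.
  have [z] : exists2 z, z \in `]0, y[%R & sin y - sin 0 = cos z * (y - 0).
    apply: MVT => //; by apply: continuous_subspaceT; exact: continuous_sin.
  rewrite in_itv/= sin0 !subr0 => /andP[z0 zy] ->.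
  apply: ler_wpM2r; first exact: ltW.
  apply: (le_trans c_1); rewrite le_eqVlt; apply/orP; right.
  by rewrite ltr_cos ?in_itv/=; lra.
have mono (a b : R) : 0 <= a -> a <= b -> b <= trigo.pi / 2 -> sin a <= sin b.
  move=> a0; rewrite le_eqVlt => /orP[/eqP->//|ab] bp.
  by apply: ltW; rewrite ltr_sin ?in_itv/=; lra.
have [y_2|y_2] := lerP y (trigo.pi / 2).
  have h1 := mono 1 y ler01 (ltW y_1) y_2.
  have : c * y <= sin 1 / 4 * 4 by apply: ler_pM; lra.
  by lra.
have -> : sin y = sin (trigo.pi - y).
  by rewrite sinB sinpi cospi; ring.
have h1 : sin (eta * trigo.pi) <= sin (trigo.pi - y).
  by apply: mono; [rewrite mulr_ge0 ?ltW//; lra|nra|lra].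
have : c * y <= sin (eta * trigo.pi) / 4 * 4 by apply: ler_pM; lra.
by lra.
Qed.

(** The telescoped sum bounds |kernel| |sin (pi u)| by 1. For [x] and [t] in [0, 1[ the difference u
    = x - t may approach -1 or 1, where the kernel is large again; keeping [x] at distance [eta]
    from both ends prevents this. *)
Lemma kernel_decay (eta : R) : 0 < eta <= 2^-1 ->
  exists C : R, 0 < C /\ forall n u, `|u| <= 1 - eta ->
    normc (kernel n u) * `|u| <= C.
Proof.
move=> heta; have [c [c0 hc]] := sin_lower_bound heta.
have pi0 := @pi_gt0 R.
exists (c * trigo.pi)^-1; split; first by rewrite invr_gt0 mulr_gt0.
move=> n u hu.
have h1 : c * trigo.pi * `|u| <= `|sin (trigo.pi * u)|.
  have -> : `|sin (trigo.pi * u)| = `|sin (trigo.pi * `|u|)|.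
    have [u0|u0] := lerP 0 u; first by rewrite [`|u|]ger0_norm.
    by rewrite [`|u|]ltr0_norm// mulrN sinN normrN.
  apply: le_trans (ler_norm _); rewrite -mulrA; apply: hc.
  by rewrite mulr_ge0 ?(ltW pi0)//= mulrC ler_pM2r.
have h2 : normc (kernel n u) * (2 * `|sin (trigo.pi * u)|) <= 2.
  rewrite -normc_fourier_exp1B -normcM kernel_geometric.
  by rewrite (le_trans (ler_normcD _ _))// normc_opp !normc_fourier_exp.
rewrite -[leRHS]mul1r ler_pdivlMr ?mulr_gt0//.
have := normc_ge0 (kernel n u); move: h1 h2; move: (normc _) => K.
move: (`|sin _|) => S h1 h2 K0.
have : K * (c * trigo.pi * `|u|) <= K * S by apply: ler_wpM2l.
by lra.
Qed.

End DirichletKernel.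

(** * Domination of partial sums by dyadic averages *)

Section DyadicBound.
Context (R : realType).
Let mu := @circle_measure R.

Definition dball (x : R) (i : nat) : set (measurableTypeR R) :=
  `[x - 2^-1 ^+ i, x + 2^-1 ^+ i]%classic.

Lemma measurable_dball x i : measurable (dball x i).
Proof. exact: measurable_itv. Qed.

Lemma indic_dball x i t :
  \1_(dball x i) t = (`|x - t| <= 2^-1 ^+ i)%R%:R :> R.
Proof.
rewrite indicE /dball mem_setE in_itv /=; congr (_ %:R); congr (nat_of_bool _).
by rewrite ler_norml; apply/idP/idP => /andP[h1 h2]; apply/andP; split; lra.
Qed.

(** Let i be the largest index up to [N] with d <= 2^-i. Then y <= 2^(i + 1), either by the bound
    2^N or because d > 2^-(i + 1) and y d <= 1, so the term of index i already suffices. *)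
Lemma le_sum_dyadic (N : nat) (y d : R) : 0 <= d <= 1 -> y <= 2 ^+ N -> y * d <= 1 ->
  y <= 2 * \sum_(i < N.+1) 2 ^+ i * (d <= 2^-1 ^+ i)%R%:R.
Proof.
move=> /andP[d0 d1].
have S0 N' : 0 <= \sum_(i < N') 2 ^+ i * (d <= 2^-1 ^+ i)%R%:R :> R.
  by apply: sumr_ge0 => i _; rewrite mulr_ge0// exprn_ge0.
elim: N => [|N IH] yN yd.
  by rewrite big_ord1 !expr0 d1 /= mulr1 in yN *; lra.
rewrite big_ord_recr /=; have [dN|dN] := lerP d (2^-1 ^+ N.+1).
  have := S0 N.+1; have : 0 < (2 : R) ^+ N.+1 by rewrite exprn_gt0.
  by rewrite /= mulr1; lra.
rewrite mulr0 addr0; have [/IH h|h] := lerP y (2 ^+ N); first exact: h.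
rewrite big_ord_recr /=.
have -> : (d <= 2^-1 ^+ N) = true.
  have N0 : 0 < (2 : R) ^+ N by rewrite exprn_gt0.
  rewrite exprVn -(ler_pM2l N0) mulfV ?gt_eqF//.
  by apply: le_trans yd; apply: ler_wpM2r => //; exact: ltW.
by have := S0 N; move: yN; rewrite exprS /= mulr1; lra.
Qed.

Lemma int_le_circle (f g : measurableTypeR R -> R) : integ f -> integ g ->
  (forall t, circle t -> f t <= g t) -> \int[mu]_t f t <= \int[mu]_t g t.
Proof.
move=> hf hg fg; rewrite !int_circle//.
have mC := @measurable_circle R.
by apply: le_Rintegral => //; [apply: (integrableS measurableT) hf|
  apply: (integrableS measurableT) hg].
Qed.

Lemma kernel_dyadic (eta : R) : 0 < eta <= 2^-1 ->
  exists C : R, 0 < C /\ forall n N x t, eta <= x <= 1 - eta -> circle t ->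
    (n.*2.+1 <= 2 ^ N)%N ->
    normc (kernel n (x - t)) <=
    C * \sum_(i < N.+1) 2 ^+ i * \1_(dball x i) t.
Proof.
move=> heta; have /andP[eta0 eta1] := heta.
have [C0 [C00 hC]] := kernel_decay heta.
(* Dividing the kernel by [C1] makes both of its bounds, 2^N and 1 / |x - t|, hold without
   constants. *)
pose C1 := Num.max 1 C0.
have C11 : 1 <= C1 by rewrite /C1 le_max lexx.
have C1C0 : C0 <= C1 by rewrite /C1 le_max lexx orbT.
exists (2 * C1); split; first by lra.
move=> n N x t hx; rewrite /circle /= in_itv /= => ht nN.
have hd : `|x - t| <= 1 - eta by rewrite ler_norml; lra.
have := hC n (x - t) hd; have := normc_kernel_le n (x - t).
have := normc_ge0 (kernel n (x - t)); move: (normc _) => K K0 K1 K2.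
have K1' : K <= 2 ^+ N.
  by apply: (le_trans K1); rewrite -natrX ler_nat.
have C1gt : 0 < C1 by lra.
have -> : \sum_(i < N.+1) 2 ^+ i * \1_(dball x i) t =
    \sum_(i < N.+1) 2 ^+ i * (`|x - t| <= 2^-1 ^+ i)%R%:R :> R.
  by apply: eq_bigr => i _; rewrite indic_dball.
have h := @le_sum_dyadic N (K / C1) `|x - t|.
 rewrite mulrAC -ler_pdivrMr//; apply: h.
- by rewrite normr_ge0 (le_trans hd)//; lra.
- rewrite ler_pdivrMr//; apply: (le_trans K1').
  by rewrite ler_peMr// exprn_ge0.
- by rewrite mulrAC ler_pdivrMr// mul1r (le_trans K2).
Qed.

Lemma integM_indic (f : measurableTypeR R -> R) (A : set (measurableTypeR R)) :
  measurable A -> integ f -> integ (fun t => f t * \1_A t).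
Proof.
move=> mA hf; have mf := integ_measurable hf.
have nf : integ (fun t => `|f t|) by exact: integrable_norm.
apply: integ_le nf.
  by apply: measurable_funM => //; exact: measurable_indic.
move=> t; rewrite normrM indicE; case: (_ \in _); last by rewrite normr0 mulr0.
by rewrite normr1 mulr1.
Qed.

Lemma fourier_sum_dyadic (eta : R) : 0 < eta <= 2^-1 ->
  exists C : R, 0 < C /\ forall f n N x, cinteg f -> eta <= x <= 1 - eta ->
    (n.*2.+1 <= 2 ^ N)%N ->
    normc (fourier_sum n f x) <= C * \sum_(i < N.+1)
       2 ^+ i * \int[mu]_t (normc (f t) * \1_(dball x i) t).
Proof.
move=> heta; have [C [C0 hC]] := kernel_dyadic heta.
exists (2 * C); split; first by rewrite mulr_gt0.
move=> f n N x hf hx nN; apply: le_trans (normc_fourier_sum_le _ _ hf) _.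
have hn := hf.2.
have hi i : integ (fun t => normc (f t) * \1_(dball x i) t).
  by apply: integM_indic => //; exact: measurable_dball.
have hs : integ (fun t => \sum_(i < N.+1) 2 ^+ i * (normc (f t) * \1_(dball x i) t)).
  by apply: integ_sum => i; exact: integZ.
rewrite -mulrA ler_pM2l//.
under eq_bigr do rewrite -intZ//.
rewrite -int_sum; last by move=> i; exact: integZ.
rewrite -intZ//; apply: int_le_circle.
- have := (cintegM hf (cmeas_kernel n x) (fun t => normc_kernel_le n (x - t))).2.
  by congr integ; apply/funext => t /=; rewrite normcM.
- exact: integZ.
move=> t ht; apply: le_trans (ler_wpM2l (normc_ge0 _) (hC n N x t hx ht nN)) _.
rewrite mulrCA ler_pM2l// mulr_sumr le_eqVlt; apply/orP; left; apply/eqP.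
by apply: eq_bigr => i _; rewrite mulrCA.
Qed.

(** Logarithmic growth for bounded [f]: each of the [N.+1] dyadic balls contributes at most 2 B. *)
Lemma fourier_sum_bounded (eta : R) : 0 < eta <= 2^-1 ->
  exists C : R, 0 < C /\ forall f n N x (B : R), cmeas f ->
    (forall t, normc (f t) <= B) -> eta <= x <= 1 - eta ->
    (n.*2.+1 <= 2 ^ N)%N ->
    normc (fourier_sum n f x) <= C * B * N.+1%:R.
Proof.
move=> heta; have [C [C0 hC]] := fourier_sum_dyadic heta.
exists (2 * C); split; first by rewrite mulr_gt0.
move=> f n N x B mf fB hx nN.
have hf := cinteg_bounded mf fB.
have B0 : 0 <= B := le_trans (normc_ge0 _) (fB 0).
apply: le_trans (hC f n N x hf hx nN) _.
have -> : 2 * C * B * N.+1%:R = C * (2 * B * N.+1%:R) by ring.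
rewrite ler_pM2l//.
apply: (@le_trans _ _ (\sum_(i < N.+1) 2 * B)); last first.
  by rewrite sumr_const card_ord mulr_natr.
apply: ler_sum => i _.
have i0 : 0 < (2 : R) ^+ i by rewrite exprn_gt0.
rewrite mulrC -ler_pdivlMr//.
apply: (@le_trans _ _ (\int[mu]_t (B * \1_(dball x i) t))).
  apply: int_le.
  - by apply: integM_indic => //; [exact: measurable_dball|exact: hf.2].
  - by apply: integZ; apply: integ_indic; exact: measurable_dball.
  move=> t; apply: ler_wpM2r; last exact: fB.
  by rewrite indicE; case: (_ \in _).
rewrite intZ; last by apply: integ_indic; exact: measurable_dball.
have -> : 2 * B / 2 ^+ i = B * (2 / 2 ^+ i) by ring.
apply: ler_wpM2l => //.
have h : x - 2^-1 ^+ i <= x + 2^-1 ^+ i.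
  have : 0 <= (2^-1 : R) ^+ i by rewrite exprn_ge0.
  lra.
by apply: le_trans (int_indic_le h) _; rewrite exprVn; lra.
Qed.

(** Integrate [le_addr_powR] over the ball: the constant term accounts for at most half of 4 L, and
    the rest must come from the p-th powers. *)
Lemma mass_lower_bound (p L : R) (g : measurableTypeR R -> R) x i :
  1 < p -> 0 < L -> (forall t, 0 <= g t) -> integ g ->
  integ (fun t => g t `^ p) ->
  4 * L < 2 ^+ i * \int[mu]_t (g t * \1_(dball x i) t) ->
  2^-1 ^+ i * L `^ p <= \int[mu]_t (g t `^ p * \1_(dball x i) t).
Proof.
move=> p1 L0 g0 hg hgp H.
have mB := measurable_dball x i.
set nu := \int[mu]_t (g t `^ p * _ t) in H *.
have hp : integ (fun t => g t `^ p * \1_(dball x i) t) by exact: integM_indic.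
have ineq : \int[mu]_t (g t * \1_(dball x i) t) <=
    L * (2 * 2^-1 ^+ i) + L `^ (1 - p) * nu.
  apply: (@le_trans _ _ (\int[mu]_t (L * \1_(dball x i) t +
      L `^ (1 - p) * (g t `^ p * \1_(dball x i) t)))).
    apply: int_le; [exact: integM_indic| |].
      by apply: integD; apply: integZ => //; exact: integ_indic.
    move=> t; rewrite mulrA -mulrDl; apply: ler_wpM2r.
      by rewrite indicE; case: (_ \in _).
    by apply: le_addr_powR => //; exact: ltW.
  rewrite intD; [|by apply: integZ; exact: integ_indic|exact: integZ].
  rewrite !intZ//; last exact: integ_indic.
  rewrite lerD2r ler_pM2l//.
  have h : x - 2^-1 ^+ i <= x + 2^-1 ^+ i.
    have : 0 <= (2^-1 : R) ^+ i by rewrite exprn_ge0.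
  lra.
  by apply: le_trans (int_indic_le h) _; lra.
have i0 : 0 < (2 : R) ^+ i by rewrite exprn_gt0.
have {}ineq := ler_wpM2l (ltW i0) ineq.
have e1 : (2 : R) ^+ i * 2^-1 ^+ i = 1 by rewrite -exprMn divff ?expr1n.
have {}ineq : 2 * L < 2 ^+ i * (L `^ (1 - p) * nu).
  have -> : 2 * L = 4 * L - L * (2 * (2 ^+ i * 2^-1 ^+ i)) by rewrite e1; lra.
  rewrite ltrBlDl; apply: (lt_le_trans H); apply: (le_trans ineq).
  by rewrite mulrDr lerD2r le_eqVlt; apply/orP; left; apply/eqP; ring.
have Lp : L `^ p * L `^ (1 - p) = L.
  rewrite -powRD; last by rewrite (gt_eqF L0) implybT.
  by rewrite addrC subrK powRr1// ltW.
have L1 : 0 < L `^ (1 - p) by rewrite powR_gt0.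
rewrite -(ler_pM2l i0) mulrA e1 mul1r -(ler_pM2r L1) Lp.
by move: ineq; rewrite mulrCA mulrC; lra.
Qed.

(** With [N] of the order of log n, this is how logarithmic factors are absorbed by small powers of
    n. *)
Lemma linear_le_exp (gamma K : R) : 0 < gamma ->
  exists N0, forall N, (N0 <= N)%N -> K * N.+1%:R <= 2 `^ (gamma * N%:R).
Proof.
move=> g0; have l2 : 0 < ln 2 :> R by rewrite ln_gt0// ltr1n.
pose c : R := gamma * ln 2 / 2.
have c0 : 0 < c by rewrite divr_gt0// mulr_gt0.
have K2c : 0 <= 2 * `|K| / c ^+ 2 by apply: divr_ge0; [exact: mulr_ge0|exact: sqr_ge0].
exists (Num.trunc (2 * `|K| / c ^+ 2)).+1 => N hN0.
have hN : 2 * `|K| <= c ^+ 2 * N%:R.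
  rewrite [leRHS]mulrC -ler_pdivrMr ?exprn_gt0//; apply: ltW.
  have /andP[_ h] := truncn_itv K2c.
  by apply: (lt_le_trans h); rewrite ler_nat.
have N1 : 1 <= N%:R :> R.
  by rewrite ler1n; apply: leq_ltn_trans hN0.
(* Writing the exponential as a square turns 1 + x <= exp x into quadratic growth, which beats a
   linear term. *)
have -> : 2 `^ (gamma * N%:R) = expR (c * N%:R) ^+ 2.
  by rewrite /powR gt_eqF// -expRM_natl; congr expR; rewrite /c; field.
have := expR_ge1Dx (c * N%:R); set E := expR _ => hE.
have KK := ler_norm K.
have cN : 0 < c * N%:R by rewrite mulr_gt0//; lra.
apply: (@le_trans _ _ ((c * N%:R) ^+ 2)); last first.
  by apply: lerXn2r; rewrite ?nnegrE; lra.
have -> : (c * N%:R) ^+ 2 = c ^+ 2 * N%:R * N%:R by ring.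
apply: (@le_trans _ _ (2 * `|K| * N%:R)); last by apply: ler_wpM2r => //; lra.
by rewrite -natr1; have := normr_ge0 K; nra.
Qed.

End DyadicBound.

(** * Large partial sums occur on small sets *)

Section UpperBound.
Context (R : realType).
Let mu := @circle_measure R.
Implicit Types (f : measurableTypeR R -> R[i]) (b x : R).

Lemma bigO_powP (u : nat -> R) b : (forall n, 0 <= u n) ->
  u =O_\oo (fun n => n%:R `^ b) <->
  exists C n0, forall n, (n0 <= n)%N -> u n <= C * n%:R `^ b.
Proof.
move=> u0; split.
  move=> /eqO_exP[C [C0 [n0 _ H]]]; exists C, n0 => n /H /=.
  by rewrite !ger0_norm ?powR_ge0.
move=> [C [n0 H]]; apply/eqO_exP; exists (Num.max C 1).
  by rewrite lt_max ltr01 orbT.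
  exists n0 => // n /H /= h; rewrite !ger0_norm ?powR_ge0//.
  by apply: (le_trans h); rewrite ler_wpM2r ?powR_ge0// le_max lexx.
Qed.

Lemma bigO_pow_le (u : nat -> R) b b' : (forall n, 0 <= u n) -> b <= b' ->
  u =O_\oo (fun n => n%:R `^ b) -> u =O_\oo (fun n => n%:R `^ b').
Proof.
move=> u0 bb' /(bigO_powP _ u0)[C [n0 H]]; apply/bigO_powP => //.
exists `|C|, (maxn n0 1) => n; rewrite geq_max => /andP[/H h n1].
apply: (le_trans h); apply: (@le_trans _ _ (`|C| * n%:R `^ b)).
  by rewrite ler_wpM2r ?powR_ge0// ler_norm.
by rewrite ler_wpM2l// ler_powR// ler1n.
Qed.

(** Ensures that the infimum defining [divergence_index] is over a nonempty set and not a default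
    value of [inf]. *)
Lemma fourier_sum_bigO1 f x : cinteg f ->
  (fun n => normc (fourier_sum n f x)) =O_\oo (fun n => n%:R `^ 1).
Proof.
move=> hf; apply/bigO_powP; first by move=> n; exact: normc_ge0.
set I := \int[mu]_t normc (f t).
have I0 : 0 <= I by apply: Rintegral_ge0 => t _; exact: normc_ge0.
exists (2 * I * 3), 1%N => n n1.
apply: le_trans (normc_fourier_sum_le_int _ _ hf) _.
rewrite powRr1//.
have : n.*2.+1%:R <= 3 * n%:R :> R by rewrite -natrM ler_nat; lia.
by rewrite -/I => h; nra.
Qed.

Lemma divergence_index_ge0 f x : cinteg f -> 0 <= divergence_index f x.
Proof.
move=> hf; apply: lb_le_inf; last by move=> b [].
by exists 1; split=> //; exact: fourier_sum_bigO1.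
Qed.

Lemma divergence_index_le f x b : 0 <= b ->
  (fun n => normc (fourier_sum n f x)) =O_\oo (fun n => n%:R `^ b) ->
  divergence_index f x <= b.
Proof.
move=> b0 H; apply: ge_inf; last by split.
by exists 0 => y [].
Qed.

Lemma divergence_index_lt f x b : cinteg f -> divergence_index f x < b ->
  (fun n => normc (fourier_sum n f x)) =O_\oo (fun n => n%:R `^ b).
Proof.
move=> hf /inf_lt[|c [c0 hc] cb].
  by exists 1; split=> //; exact: fourier_sum_bigO1.
by apply: bigO_pow_le hc; [move=> n; exact: normc_ge0|exact: ltW].
Qed.

(** Pigeonhole over the N + 1 scales finds a ball whose mean is at least of order 2^(N b'). By
    [mass_lower_bound] its mass is at least 2^(-i + b' p N), which is enough as i <= N. *)
Lemma divergent_mass (eta p b b' : R) f x :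
  0 < eta <= 2^-1 -> 1 < p -> 0 < b' < b -> cinteg f ->
  integ (fun t => normc (f t) `^ p) -> eta <= x <= 1 - eta ->
  (forall n0, exists n, (n0 <= n)%N /\ n%:R `^ b < normc (fourier_sum n f x)) ->
  forall i0, exists i, (i0 <= i)%N /\
    2 `^ (- (1 - b' * p) * i%:R) <=
    \int[mu]_t (normc (f t) `^ p * \1_(dball x i) t).
Proof.
move=> heta p1 /andP[b'0 bb'] hf hfp hx H i0.
have [C [C0 hC]] := fourier_sum_dyadic heta.
set nu := \int[mu]_t (normc (f t) `^ p).
have nu0 : 0 <= nu by apply: Rintegral_ge0 => t _; exact: powR_ge0.
have g1 : 0 < b - b' by rewrite subr_gt0.
have g2 : 0 < b' * p by rewrite mulr_gt0//; lra.
(* [N1] lets the gap between b and b' absorb the number of scales. [N2] makes the mass found at a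
   scale below [i0] exceed the total mass [nu], which excludes such scales. *)
have [N1 hN1] := linear_le_exp (4 * C * 6 `^ b) g1.
have [N2 hN2] := linear_le_exp (2 ^+ i0 * nu + 1) g2.
have [n [hn Hn]] := H (2 ^ (maxn 1 (maxn N1 N2)))%N.
have n1 : (1 <= n)%N by apply: leq_trans hn; rewrite expn_gt0.
have /andP[k1 k2] := trunc_log_bounds (isT : (1 < 2)%N) (isT : (0 < n.*2.+1)%N).
set N := (trunc_log 2 n.*2.+1).+1 in k2.
have nN : (n.*2.+1 <= 2 ^ N)%N by exact: ltnW.
have Nn : (2 ^ N <= 6 * n)%N.
  have -> : (2 ^ N = 2 * 2 ^ trunc_log 2 n.*2.+1)%N by rewrite -expnS.
  by move: k1 n1; clear; move: (2 ^ _)%N => T; lia.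
have NN : (maxn 1 (maxn N1 N2) <= N)%N.
  rewrite -(@leq_exp2l 2)//; apply: leq_trans hn _; apply: leq_trans nN.
  by rewrite -addnn -addnS leq_addr.
move: NN; rewrite !geq_max => /and3P[_ NN1 NN2].
have [i [iN hi]] : exists i, (i <= N)%N /\ 4 * 2 `^ (N%:R * b') <
    2 ^+ i * \int[mu]_t (normc (f t) * \1_(dball x i) t).
  apply: contrapT => /forallNP K.
  have : normc (fourier_sum n f x) <= n%:R `^ b; last by rewrite leNgt Hn.
  apply: le_trans (hC f n N x hf hx nN) _.
  apply: (@le_trans _ _ (C * \sum_(i < N.+1) 4 * 2 `^ (N%:R * b'))).
    rewrite ler_pM2l//; apply: ler_sum => i _.
    have /not_andP[|/negP] := K i; first by have := ltn_ord i; rewrite ltnS => ->.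
    by rewrite -leNgt.
  rewrite sumr_const card_ord -(mulr_natr _ N.+1).
  have := hN1 N NN1; rewrite mulrBl powRB; last by rewrite pnatr_eq0 implybT.
  have h6 : 2 `^ (b * N%:R) <= 6 `^ b * n%:R `^ b :> R.
    rewrite mulrC powRrM powR_mulrn// -powRM//.
    apply: ge0_ler_powR; rewrite ?nnegrE ?exprn_ge0 ?mulr_ge0//; first lra.
    by rewrite -natrX -natrM ler_nat.
  have q0 : 0 < 6 `^ b :> R by rewrite powR_gt0.
  rewrite [N%:R * b']mulrC; set P := 2 `^ (b' * _).
  have P0 : 0 < P by rewrite powR_gt0.
  rewrite ler_pdivlMr// => h7; have := le_trans h7 h6.
  have -> : 4 * C * 6 `^ b * N.+1%:R * P = 6 `^ b * (C * (4 * P * N.+1%:R)) by ring.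
  by rewrite (ler_pM2l q0).
have L0 : 0 < 2 `^ (N%:R * b') :> R by rewrite powR_gt0.
have := mass_lower_bound p1 L0 (fun t => normc_ge0 (f t)) hf.2 hfp hi.
set nui := \int[mu]_t _ => hnu.
have nuinu : nui <= nu.
  apply: int_le => //; first by apply: integM_indic => //; exact: measurable_dball.
  move=> t; rewrite indicE ler_piMr ?powR_ge0//; case: (_ \in _) => //=.
have e1 : (2 `^ (N%:R * b')) `^ p = 2 `^ (b' * p * N%:R) :> R.
  by rewrite -powRrM; congr (_ `^ _); ring.
exists i; split.
  rewrite leqNgt; apply/negP => ii0.
  have h := hN2 N NN2.
  have : 2 `^ (b' * p * N%:R) <= 2 ^+ i0 * nu.
    have i2 : 0 < (2 : R) ^+ i by rewrite exprn_gt0.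
    have : 2 `^ (b' * p * N%:R) <= 2 ^+ i * nu.
      rewrite -e1 -(ler_pM2l (_ : 0 < 2^-1 ^+ i)) ?exprn_gt0 ?invr_gt0//.
      apply: (le_trans hnu); apply: (le_trans nuinu).
      by rewrite mulrA -exprMn mulVf// expr1n mul1r.
    move=> /le_trans; apply; apply: ler_wpM2r => //.
    by apply: ler_weXn2l; [rewrite ler1n|exact: ltnW].
  have : 1 <= N.+1%:R :> R by rewrite ler1n.
  have : 0 <= 2 ^+ i0 * nu by rewrite mulr_ge0// exprn_ge0.
  by move: h; nra.
apply: le_trans hnu; rewrite e1.
have -> : (2^-1 : R) ^+ i = 2 `^ (- i%:R) by rewrite powRN powR_mulrn// exprVn.
rewrite -powRD; last by rewrite pnatr_eq0 implybT.
apply: ler_powR; first by rewrite ler1n.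
have : b' * p * i%:R <= b' * p * N%:R by rewrite ler_pM2l// ler_nat.
by lra.
Qed.

Lemma hnull_set1 (s a : R) : 0 < s -> hnull s [set a].
Proof.
move=> s0 e e0; exists (fun=> [set a]), (fun=> 0); split=> //.
- by move=> x ->; exists 0%N.
- move=> i x y /= -> ->; rewrite circle_dist_small subrr normr0 ?invr_ge0//.
  by rewrite powR0// gt_eqF.
- by move=> n; rewrite big1// ltW.
Qed.

Lemma hnull_mass (g : measurableTypeR R -> R) (s s' : R) (E : set R) :
  (forall t, 0 <= g t) -> integ g -> s < s' -> 0 <= s' ->
  (forall x, E x -> 0 < x) ->
  (forall x, E x -> forall i0, exists i, (i0 <= i)%N /\
    2 `^ (- s * i%:R) <= \int[mu]_t (g t * \1_(dball x i) t)) ->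
  hnull s' E.
Proof.
move=> g0 hg ss' s'0 E0 HE.
(* The dyadic interval enlarged by one neighbour on each side contains the balls of radius 2^-i
   centred in it; a point lies in at most 4 of these closed intervals. *)
pose J i (k : nat) : set (measurableTypeR R) :=
  `[(k%:R - 1) / 2 ^+ i, (k%:R + 2) / 2 ^+ i]%classic.
have mJ i k : measurable (J i k) by exact: measurable_itv.
have JE i k t : \1_(J i k) t = (k%:R - 1 <= t * 2 ^+ i <= k%:R + 2)%R%:R :> R.
  have i2 : 0 < (2 : R) ^+ i by rewrite exprn_gt0.
  by rewrite indicE /J mem_setE in_itv /= ler_pdivrMr// ler_pdivlMr.
apply: (@hnull_dyadic R s s' (fun i k => \int[mu]_t (g t * \1_(J i k) t))
   (\int[mu]_t (4 * g t)) E) => //.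
- move=> i k; apply: Rintegral_ge0 => t _; apply: mulr_ge0; first exact: g0.
  by rewrite indicE; case: (_ \in _).
- move=> i n; rewrite -int_sum; last by move=> k; exact: integM_indic.
  apply: int_le.
  + by apply: integ_sum => k; exact: integM_indic.
  + exact: integZ.
  move=> t; rewrite -mulr_sumr mulrC ler_wpM2r//.
  under eq_bigr do rewrite JE.
  rewrite -natr_sum.
  have := @card_le_diff R n (fun k => k%:R - 1 <= t * 2 ^+ i <= k%:R + 2) 3.
  have -> : (3 + 1 = 4 :> R) by ring.
  by apply=> // k l _ _; lra.
move=> x Ex i0; have [i [ii0 hi]] := HE x Ex i0.
have i2 : 0 < (2 : R) ^+ i by rewrite exprn_gt0.
have x2 : 0 <= x * 2 ^+ i by apply: mulr_ge0; apply: ltW => //; exact: E0.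
have /andP[k1 k2] := truncn_itv x2; set k := Num.trunc _ in k1 k2.
exists i, k; split=> //; first by rewrite k1 natr1.
apply: (le_trans hi); apply: int_le.
- by apply: integM_indic => //; exact: measurable_dball.
- exact: integM_indic.
move=> t; apply: ler_wpM2l => //; rewrite indic_dball JE.
case: (lerP `|x - t| (2^-1 ^+ i)) => //= ht.
have {}ht : `|x - t| * 2 ^+ i <= 1.
  by rewrite -ler_pdivlMr// mul1r -exprVn.
have -> // : k%:R - 1 <= t * 2 ^+ i <= k%:R + 2.
move: k2; rewrite -natr1 => k2.
move: ht; rewrite -[X in _ * X](gtr0_norm i2) -normrM mulrBl ler_norml; lra.
Qed.

Lemma hnull_divergence (p b s : R) f :
  1 < p -> 0 < b -> 0 < s -> 1 - b * p < s -> cinteg f ->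
  integ (fun t => normc (f t) `^ p) ->
  hnull s [set x | circle x /\ b <= divergence_index f x].
Proof.
move=> p1 b0 s0 hs hf hfp; have p0 : 0 < p by lra.
have bs : (1 - s) / p < b by rewrite ltr_pdivrMr//; lra.
(* Any positive b' < b with 1 - b' p < s would do; the maximum with 0 keeps it positive also when s
   > 1. *)
pose b' := (Num.max 0 ((1 - s) / p) + b) / 2.
have m0 : Num.max 0 ((1 - s) / p) < b by rewrite gt_max b0.
have m1 : 0 <= Num.max 0 ((1 - s) / p) by rewrite le_max lexx.
have m2 : (1 - s) / p <= Num.max 0 ((1 - s) / p) by rewrite le_max lexx orbT.
have b'0 : 0 < b' by rewrite /b'; lra.
have b'b : b' < b by rewrite /b'; lra.
have b's : 1 - b' * p < s.
  have : (1 - s) / p < b' by rewrite /b'; lra.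
  by rewrite ltr_pdivrMr//; lra.
(* The kernel bounds hold away from the ends of [0, 1[. These sets exhaust the part of the circle
   under study except the point 0, which is null by itself; the shift by 2 keeps the margin at most
   1/2. *)
pose E (m : nat) := [set x : R | m.+2%:R^-1 <= x <= 1 - m.+2%:R^-1 /\
  b <= divergence_index f x].
have hE m : hnull s (E m).
  have m20 : 0 < m.+2%:R^-1 :> R by rewrite invr_gt0 ltr0n.
  have heta : 0 < (m.+2%:R^-1 : R) <= 2^-1.
    by rewrite m20 /= lef_pV2 ?posrE ?ltr0n// ler_nat.
  apply: (hnull_mass (fun t => powR_ge0 _ _) hfp b's (ltW s0)).
    by move=> x [/andP[h _] _]; exact: lt_le_trans h.
  move=> x [hx hb]; pose b'' := (b' + b) / 2.
  apply: (@divergent_mass _ p b'' b' f x heta) => //.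
    by rewrite b'0 /= /b''; lra.
  move=> n0; apply: contrapT => /forallNP H.
  have : divergence_index f x <= b''; last first.
    by rewrite leNgt (lt_le_trans _ hb)// /b''; lra.
  apply: divergence_index_le; first by rewrite /b''; lra.
  apply/bigO_powP; first by move=> n; exact: normc_ge0.
  exists 1, n0 => n n0n; rewrite mul1r leNgt; apply/negP => h.
  exact: (H n).
apply: (sub_hnull _ (hnullU (hnull_set1 0 s0) (hnull_bigcup hE))).
move=> x [/= xC xb].
have [->|x0] := eqVneq x 0; [by left|right].
move: xC; rewrite /circle /= in_itv/= => /andP[x0' x1].
have {}x0 : 0 < x by rewrite lt0r x0.
pose y := Num.min x (1 - x).
have y0 : 0 < y by rewrite lt_min x0 subr_gt0.
have yV : 0 <= y^-1 by rewrite invr_ge0 ltW.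
have /andP[_ hm] := truncn_itv yV; set m := Num.trunc _ in hm.
exists m => //; split=> //.
have : m.+2%:R^-1 <= y.
  rewrite -[leRHS]invrK lef_pV2 ?posrE ?ltr0n ?invr_gt0//.
  by apply: ltW; apply: (lt_le_trans hm); rewrite ler_nat.
rewrite /y le_min; move: (m.+2%:R^-1) => z /andP[h1 h2].
by apply/andP; split=> //; lra.
Qed.

End UpperBound.

(** * Spikes *)

Section Bump.
Context (R : realType).
Let mu := @circle_measure R.
Local Notation fe := (@fourier_exp R).

Lemma int_derive (f F : R -> R) : continuous f ->
  (forall t : R, is_derive t (1 : R) F (f t)) ->
  \int[@lebesgue_measure R]_(t in `[0, 1]) f t = F 1 - F 0.
Proof.
move=> cf dF.
have cF t : {for t, continuous F}.
  by apply/differentiable_continuous/derivable1_diffP; case: (dF t).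
rewrite /Rintegral (@continuous_FTC2 R f F 0 1)//.
- exact: continuous_subspaceT.
- split.
  + by move=> t _; case: (dF t).
  + by apply: cvg_at_right_filter; exact: cF.
  + by apply: cvg_at_left_filter; exact: cF.
by move=> t _; rewrite derive1E; case: (dF t).
Qed.

Lemma cinteg_fourier_exp k : cinteg (fe k).
Proof.
apply: (@cinteg_bounded _ _ 1); first exact: cmeas_fourier_exp0.
by move=> t; rewrite normc_fourier_exp.
Qed.

Lemma Cintegral_fourier_exp (k : int) : Cintegral (fe k) = (k == 0)%:R.
Proof.
have [->|k0] := eqVneq k 0.
  rewrite /Cintegral (_ : fe 0 = fun=> 1); last by apply/funext => t; exact: fourier_exp0.
  by rewrite /= !int_cst.
pose c : R := 2 * trigo.pi * k%:~R.
have c0 : c != 0 by rewrite !mulf_neq0 ?intr_eq0// gt_eqF// pi_gt0.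
have ci := cinteg_fourier_exp k.
have cc (u : R -> R) : continuous u -> continuous (fun t => u (c * t)).
  move=> cu t; apply: continuous_comp; last exact: cu.
  exact: mulrl_continuous.
have dl (t : R) : is_derive t (1 : R) ( *%R c : R -> R) c.
  have := @is_deriveZ _ _ _ (id : R -> R) c t 1 1 (is_derive_id _ _).
  by rewrite /GRing.scale /= mulr1.
have hper : fe k 1 = 1.
  by have := @fourier_exp_period R k 1 1 isT; rewrite !divr1.
rewrite /fourier_exp mulr1 -/c in hper; case: hper => hc hs.
apply: complex_ext => /=.
- rewrite int_lebesgueE; last exact: (cinteg_Re ci).
  have D (t : R) : is_derive t (1 : R) (fun t => c^-1 * sin (c * t)) (cos (c * t)).
    have := is_deriveZ c^-1 (is_derive1_comp (is_derive_sin (c * t)) (dl t)).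
    rewrite /GRing.scale /= => h; apply: (is_derive_eq h).
    by rewrite mulrCA mulVf ?mulr1.
  by rewrite (int_derive (cc _ (@continuous_cos R)) D) mulr1 mulr0 hs sin0 subrr.
- rewrite int_lebesgueE; last exact: (cinteg_Im ci).
  have D (t : R) : is_derive t (1 : R) (fun t => - c^-1 * cos (c * t)) (sin (c * t)).
    have := is_deriveZ (- c^-1) (is_derive1_comp (is_derive_cos (c * t)) (dl t)).
    rewrite /GRing.scale /= => h; apply: (is_derive_eq h).
    by field.
  by rewrite (int_derive (cc _ (@continuous_sin R)) D) mulr1 mulr0 hc cos0 subrr.
Qed.

Lemma fourier_sum_exp (n k : nat) x : (k <= n)%N ->
  fourier_sum n (fe k) x = fe k x.
Proof.
move=> kn; rewrite /fourier_sum.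
have H (l : int) : fourier_coef (fe k) l = (k%:Z - l == 0)%:R.
  rewrite -Cintegral_fourier_exp /fourier_coef; congr Cintegral.
  by apply/funext => t; rewrite fourier_expDl fourier_expN.
(* The summand of index n + k is the one of frequency k. *)
have kn2 : (n + k < n.*2.+1)%N by lia.
rewrite (bigD1 (Ordinal kn2))//= big1 => [|i ik].
  by rewrite H addr0 PoszD addrAC subrr add0r subrr eqxx mul1r.
rewrite H; have -> : (k%:Z - (i%:Z - n%:Z) == 0) = false; last by rewrite mul0r.
by apply/eqP => h; move/eqP: ik; apply; apply/val_inj => /=; lia.
Qed.

Definition spike (Q M : nat) t : R[i] :=
  (M%:R^-1)%:C * \sum_(k < M) fe (k * Q)%N t.

Lemma normc_spike_le Q M t : normc (spike Q M t) <= 1.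
Proof.
rewrite /spike normcM normc_real ger0_norm ?invr_ge0//.
have [->|M0] := posnP M; first by rewrite invr0 mul0r.
rewrite mulrC ler_pdivrMr ?ltr0n// mul1r.
apply: le_trans (normc_sum_le _ _) _.
rewrite (eq_bigr (fun=> 1)) ?sumr_const ?card_ord//.
by move=> i _; rewrite normc_fourier_exp.
Qed.

Lemma cmeas_spike Q M : cmeas (spike Q M).
Proof.
apply: cmeasM; first exact: cmeas_cst.
by apply: cmeas_sum => k; exact: cmeas_fourier_exp0.
Qed.

Lemma conj_spike Q M t : (spike Q M t)^*%R =
  (M%:R^-1)%:C * \sum_(k < M) (fe (k * Q)%N t)^*.
Proof.
rewrite /spike rmorphM rmorph_sum; congr (_ * _).
by apply: complex_ext; rewrite //= oppr0.
Qed.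

(** Parseval: by orthogonality only the M diagonal terms survive, each equal to M^-2. *)
Lemma int_spike2 Q M : (0 < Q)%N -> (0 < M)%N ->
  \int[mu]_t (normc (spike Q M t) ^+ 2) = M%:R^-1.
Proof.
move=> Q0 M0.
have -> : \int[mu]_t (normc (spike Q M t) ^+ 2) =
    complex.Re (Cintegral (fun t => spike Q M t * (spike Q M t)^*)).
  rewrite /Cintegral /=; apply: eq_Rintegral => t _.
  by rewrite sqr_normc; case: (spike Q M t) => a b /=; ring.
have -> : (fun t => spike Q M t * (spike Q M t)^*) = (fun t =>
    \sum_(k < M) \sum_(l < M) ((M%:R^-1)%:C * (M%:R^-1)%:C) *
       fe ((k * Q)%N%:Z - (l * Q)%N%:Z) t).
  apply/funext => t; rewrite conj_spike /spike mulrACA.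
  rewrite big_distrlr/= mulr_sumr; apply: eq_bigr => k _.
  rewrite mulr_sumr; apply: eq_bigr => l _.
  by rewrite fourier_expDl fourier_expN.
have ci k l : cinteg (fun t => ((M%:R^-1)%:C * (M%:R^-1)%:C) *
       fe ((k * Q)%N%:Z - (l * Q)%N%:Z) t).
  by apply: cintegZ; exact: cinteg_fourier_exp.
rewrite Cintegral_sum; last by move=> k; apply: cinteg_sum.
rewrite (eq_bigr (fun=> (M%:R^-1)%:C * (M%:R^-1)%:C)); last first.
  move=> k _; rewrite Cintegral_sum; last by move=> l; exact: ci.
  rewrite (bigD1 k)//= big1 => [|l lk].
    rewrite CintegralZ; last exact: cinteg_fourier_exp.
    by rewrite Cintegral_fourier_exp subrr eqxx mulr1 addr0.
  rewrite CintegralZ; last exact: cinteg_fourier_exp.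
  rewrite Cintegral_fourier_exp; have -> : ((k * Q)%N%:Z - (l * Q)%N%:Z == 0) = false.
    apply/eqP => /eqP; rewrite subr_eq0 => /eqP [] /eqP.
    rewrite eqn_pmul2r// => /eqP kl; move/eqP: lk; apply.
    by apply/val_inj.
  by rewrite mulr0.
rewrite sumr_const card_ord.
have -> : (M%:R^-1)%:C * (M%:R^-1)%:C *+ M = (M%:R^-1 : R)%:C.
  rewrite -rmorphM -rmorphMn; congr (_%:C).
  rewrite /= -mulrnAr -[X in _ * X]mulr_natr mulVf ?mulr1//.
  by rewrite pnatr_eq0 -lt0n.
by [].
Qed.

(** After reduction modulo 1 / Q, all phases lie in [0, 1], since 2 pi < 8 and 8 M Q / (16 Q M) < 1;
    hence the real part of every exponential is at least cos 1. *)
Lemma spike_lower_bound Q M k x : (0 < Q)%N -> (0 < M)%N ->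
  k%:R / Q%:R <= x <= k%:R / Q%:R + (16 * Q%:R * M%:R)^-1 ->
  cos 1 <= normc (spike Q M x).
Proof.
move=> Q0 M0 hx.
have Q0' : 0 < Q%:R :> R by rewrite ltr0n.
have M0' : 0 < M%:R :> R by rewrite ltr0n.
apply: (@le_trans _ _ (complex.Re (spike Q M x))); last first.
  by apply: (le_trans (ler_norm _)); exact: normr_Re_le.
pose y := x - k%:R / Q%:R.
have y0 : 0 <= y by rewrite /y; lra.
have y1 : y <= (16 * Q%:R * M%:R)^-1 by rewrite /y; lra.
have E (i : 'I_M) : fe (i * Q)%N x = fe (i * Q)%N y.
  have -> : x = k%:R / Q%:R + y by rewrite /y subrKC.
  by rewrite fourier_expD PoszM fourier_exp_period// mul1r.
rewrite /spike (eq_bigr (fun i : 'I_M => fe (i * Q)%N y)); last by move=> i _; exact: E.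
rewrite ReM /= mul0r subr0 mulrC ler_pdivlMr//.
have -> : complex.Re (\sum_(i < M) fe (i * Q)%N y) =
    \sum_(i < M) cos (2 * trigo.pi * (i * Q)%:R * y).
  elim/big_rec2 : _ => // i a b _ <-; by rewrite ReD.
rewrite mulr_natr -[X in _ *+ X]card_ord -sumr_const; apply: ler_sum => i _.
have p2 := @pihalf_lt2 R; have p1 := @pihalf_ge1 R.
have : 2 * trigo.pi * (i * Q)%:R * y <= 1.
  apply: (@le_trans _ _ (8 * (M * Q)%:R * (16 * Q%:R * M%:R)^-1)).
    apply: ler_pM => //.
      by rewrite !mulr_ge0//; lra.
    apply: ler_pM => //; [lra|lra|].
    by rewrite ler_nat leq_mul2r ltnW ?orbT.
  rewrite natrM; have -> : 8 * (M%:R * Q%:R) / (16 * Q%:R * M%:R) = 2^-1 :> R.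
    by field; rewrite !gt_eqF.
  by lra.
have : 0 <= 2 * trigo.pi * (i * Q)%:R * y by rewrite !mulr_ge0//; lra.
move: (_ * y) => z z0; rewrite le_eqVlt => /orP[/eqP->//|z1].
by apply: ltW; rewrite ltr_cos ?in_itv /=; lra.
Qed.

(** The square ensures |bump|^p <= |spike|^2 for every p >= 1, so that the L^p size follows from the
    mean square of a spike. *)
Definition bump Q M t : R[i] := spike Q M t * spike Q M t.

Lemma cmeas_bump Q M : cmeas (bump Q M).
Proof. by apply: cmeasM; exact: cmeas_spike. Qed.

Lemma normc_bump Q M t : normc (bump Q M t) = normc (spike Q M t) ^+ 2.
Proof. by rewrite /bump normcM expr2. Qed.

Lemma bump_lower_bound Q M k x : (0 < Q)%N -> (0 < M)%N ->
  k%:R / Q%:R <= x <= k%:R / Q%:R + (16 * Q%:R * M%:R)^-1 ->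
  cos 1 ^+ 2 <= normc (bump Q M x).
Proof.
move=> Q0 M0 hx; rewrite normc_bump; have := spike_lower_bound Q0 M0 hx.
by apply: lerXn2r; rewrite nnegrE ?normc_ge0// ltW// cos1_gt0.
Qed.

Lemma int_bump_powR Q M (p : R) : (0 < Q)%N -> (0 < M)%N -> 1 <= p ->
  integ (fun t => normc (bump Q M t) `^ p) /\
  \int[mu]_t (normc (bump Q M t) `^ p) <= M%:R^-1.
Proof.
move=> Q0 M0 p1.
have ms : measurable_fun setT (fun t : measurableTypeR R => normc (spike Q M t)).
  by apply: cmeas_normc; exact: cmeas_spike.
have i2 : integ (fun t => normc (spike Q M t) ^+ 2).
  apply: (integ_le _ _ (integ_cst 1)); first exact: measurable_funX.
  move=> t; rewrite ger0_norm ?exprn_ge0 ?normc_ge0//.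
  by rewrite exprn_ile1 ?normc_ge0// normc_spike_le.
have le2 t : normc (bump Q M t) `^ p <= normc (spike Q M t) ^+ 2.
  rewrite normc_bump; set a := _ ^+ 2.
  have a0 : 0 <= a by rewrite exprn_ge0 ?normc_ge0.
  have a1 : a <= 1 by rewrite exprn_ile1 ?normc_ge0// normc_spike_le.
  have [->|an0] := eqVneq a 0; first by rewrite powR0// gt_eqF//; lra.
  by apply: ge1r_powR => //; rewrite lt0r an0 a0.
have ip : integ (fun t => normc (bump Q M t) `^ p).
  apply: (integ_le _ _ i2).
    by apply: measurable_normc_powR; exact: cmeas_bump.
  by move=> t; rewrite ger0_norm ?powR_ge0.
split=> //; rewrite -(int_spike2 Q0 M0); exact: int_le.
Qed.

Lemma fourier_sum_sum (I : Type) (s : seq I) (F : I -> measurableTypeR R -> R[i])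
    (n : nat) x : (forall i, cinteg (F i)) ->
  fourier_sum n (fun t => \sum_(i <- s) F i t) x =
  \sum_(i <- s) fourier_sum n (F i) x.
Proof.
move=> hF; elim: s => [|i s IH].
  under [X in fourier_sum n X]eq_fun do rewrite big_nil.
  rewrite big_nil; have := fourier_sumZ n 0 x (cinteg_fourier_exp 0).
  rewrite mul0r => e; rewrite -[RHS]e; congr fourier_sum; apply/funext => t.
  by rewrite mul0r.
under [X in fourier_sum n X]eq_fun do rewrite big_cons.
by rewrite big_cons fourier_sumD ?IH//; exact: cinteg_sum.
Qed.

Lemma fourier_sum_bump Q M n x : (2 * M * Q <= n)%N ->
  fourier_sum n (bump Q M) x = bump Q M x.
Proof.
move=> hn.
have E : bump Q M = fun t => \sum_(k < M) \sum_(l < M)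
    ((M%:R^-1)%:C * (M%:R^-1)%:C) * fe (k * Q + l * Q)%N t.
  apply/funext => t; rewrite /bump /spike mulrACA big_distrlr/= mulr_sumr.
  apply: eq_bigr => k _; rewrite mulr_sumr; apply: eq_bigr => l _.
  by rewrite PoszD fourier_expDl.
have ci (k l : nat) : cinteg (fun t => ((M%:R^-1)%:C * (M%:R^-1)%:C) *
    fe (k * Q + l * Q)%N t).
  by apply: cintegZ; exact: cinteg_fourier_exp.
rewrite E fourier_sum_sum; last by move=> k; apply: cinteg_sum => l; exact: ci.
apply: eq_bigr => k _; rewrite fourier_sum_sum; last by move=> l; exact: ci.
apply: eq_bigr => l _; rewrite fourier_sumZ; last exact: cinteg_fourier_exp.
rewrite fourier_sum_exp//; apply: leq_trans hn.
have := ltn_ord k; have := ltn_ord l; nia.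
Qed.

End Bump.

(** * Generic functions *)

Section LpSpace.
Context (R : realType) (p : R) (p1 : 1 <= p).
Let mu := @circle_measure R.
Implicit Types (f g : cLspace p1) (h : measurableTypeR R -> R[i]).

Let p0 : 0 < p. Proof. exact: lt_le_trans p1. Qed.

Lemma cLnorm_powR h :
  (cLnorm p h `^ p)%E = (\int[mu]_t (normc (h t) `^ p)%:E)%E.
Proof.
rewrite /cLnorm poweR_Lnorm; last by rewrite gt_eqF.
apply: eq_integral => t _ /=; by rewrite ger0_norm ?normc_ge0.
Qed.

Lemma integ_powR_cLnorm h : cmeas h -> (cLnorm p h < +oo)%E ->
  integ (fun t => normc (h t) `^ p).
Proof.
move=> mh hoo; apply/integrableP; split.
  by apply/measurable_EFinP; exact: measurable_normc_powR.
under eq_integral => t _ do rewrite /= ger0_norm ?powR_ge0//.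
by rewrite -cLnorm_powR poweR_lty.
Qed.

Lemma integ_powR_integ h : cmeas h -> integ (fun t => normc (h t) `^ p) ->
  cinteg h.
Proof.
move=> mh hp; split=> //.
apply: (integ_le _ _ (integD (integ_cst 1) hp)); first exact: cmeas_normc.
move=> t /=; rewrite ger0_norm ?normc_ge0//.
have [n1|n1] := lerP (normc (h t)) 1; first by rewrite (le_trans n1)// lerDl powR_ge0.
apply: (@le_trans _ _ (normc (h t) `^ p)); last by rewrite lerDr.
by apply: le1r_powR => //; exact: ltW.
Qed.

Lemma cLspace_cmeas f : cmeas f.
Proof. by split; [exact: cLfun_Re|exact: cLfun_Im]. Qed.

Lemma cLspace_powR f : integ (fun t => normc (f t) `^ p).
Proof.
by apply: integ_powR_cLnorm; [exact: cLspace_cmeas|exact: cLfun_finite].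
Qed.

Lemma cLspace_cinteg f : cinteg f.
Proof. by apply: integ_powR_integ; [exact: cLspace_cmeas|exact: cLspace_powR]. Qed.

Lemma cmeasB h h' : cmeas h -> cmeas h' -> cmeas (fun t => h t - h' t).
Proof.
move=> mh mh'; have := cmeasD mh (cmeasM (cmeas_cst (-1)) mh').
by congr cmeas; apply/funext => t; rewrite mulN1r.
Qed.

Lemma cLdiff_powR f g : integ (fun t => normc (f t - g t) `^ p).
Proof.
apply: integ_powR_cLnorm; first by apply: cmeasB; exact: cLspace_cmeas.
exact: cLdiff_lty.
Qed.

Lemma cLdist_powR f g :
  cLdist f g `^ p = \int[mu]_t (normc (f t - g t) `^ p).
Proof.
apply/EFin_inj; rewrite -poweR_EFin cLdistE cLnorm_powR /Rintegral fineK//.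
by apply: integrable_fin_num => //; exact: cLdiff_powR.
Qed.

Lemma cLdist_ge0 f g : 0 <= cLdist f g.
Proof. by rewrite -lee_fin cLdistE Lnorm_ge0. Qed.

Lemma cLdist_le f g (e : R) : 0 <= e ->
  \int[mu]_t (normc (f t - g t) `^ p) <= e `^ p -> cLdist f g <= e.
Proof.
move=> e0; rewrite -cLdist_powR => h; rewrite leNgt; apply/negP => lt.
have := gt0_ltr_powR p0 _ _ lt; rewrite !nnegrE e0 cLdist_ge0 => /(_ isT isT).
by rewrite ltNge h.
Qed.

(** Integrate [le_addr_powR] with L = lam over the circle, of measure 1; this replaces Hoelder's
    inequality at the price of the factor 2. *)
Lemma int_normc_cLdist f g (lam : R) : 0 < lam -> cLdist f g <= lam ->
  \int[mu]_t normc (f t - g t) <= 2 * lam.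
Proof.
move=> lam0 fg.
have mfg : cmeas (fun t => f t - g t) by apply: cmeasB; exact: cLspace_cmeas.
have hp := cLdiff_powR f g.
have hi := (integ_powR_integ mfg hp).2.
apply: (@le_trans _ _ (\int[mu]_t (lam + lam `^ (1 - p) * normc (f t - g t) `^ p))).
  apply: int_le => //; first by apply: integD; [exact: integ_cst|exact: integZ].
  move=> t; set y := normc _; have y0 : 0 <= y := normc_ge0 _.
  exact: le_addr_powR.
rewrite intD; [|exact: integ_cst|exact: integZ].
rewrite int_cst intZ// -cLdist_powR mulrDl !mul1r lerD2l.
apply: (@le_trans _ _ (lam `^ (1 - p) * lam `^ p)).
  apply: ler_wpM2l; first exact: powR_ge0.
  by apply: ge0_ler_powR; rewrite ?nnegrE ?cLdist_ge0// ltW.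
by rewrite -powRD ?subrK ?powRr1 ?oner_eq0// ltW.
Qed.

(** For a fixed order, the L^p distance controls partial sums uniformly in [x]; this allows the
    conditions imposed on generic functions to be open. *)
Lemma fourier_sum_cLdist f g (lam : R) n x : 0 < lam -> cLdist f g <= lam ->
  normc (fourier_sum n f x) <=
  normc (fourier_sum n g x) + 4 * n.*2.+1%:R * lam.
Proof.
move=> lam0 fg.
have mfg : cmeas (fun t => f t - g t) by apply: cmeasB; exact: cLspace_cmeas.
have ifg := integ_powR_integ mfg (cLdiff_powR f g).
have -> : fourier_sum n f x =
    fourier_sum n g x + fourier_sum n (fun t => f t - g t) x.
  rewrite -fourier_sumD//; last exact: cLspace_cinteg.
  by congr fourier_sum; apply/funext => t; rewrite subrKC.
apply: le_trans (ler_normcD _ _) _; rewrite lerD2l.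
apply: le_trans (normc_fourier_sum_le_int _ _ ifg) _.
have := int_normc_cLdist lam0 fg; have : 0 <= n.*2.+1%:R :> R by [].
by move: (n.*2.+1%:R) (\int[mu]_t _) => N I N0 hI; nra.
Qed.

(** Partial sums and L^p distances do not see a change of representative on a null set, so
    constructions can be carried out on concrete functions. *)
Lemma cLspace_of h : cmeas h -> integ (fun t => normc (h t) `^ p) ->
  exists F : cLspace p1,
    (forall n x, fourier_sum n F x = fourier_sum n h x) /\
    (forall f, \int[mu]_t (normc (f t - F t) `^ p) =
               \int[mu]_t (normc (f t - h t) `^ p)).
Proof.
move=> mh hp.
have fin : finite_norm mu p%:E (@normc R \o h).
  rewrite /finite_norm -[X in (X < _)%E]/(cLnorm p h).
  have : (cLnorm p h `^ p < +oo)%E.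
    rewrite cLnorm_powR; have := integrable_fin_num measurableT hp.
    by rewrite ge0_fin_numE//; apply: integral_ge0 => t _; rewrite lee_fin powR_ge0.
  have := Lnorm_ge0 mu p%:E (EFin \o (@normc R \o h)).
  rewrite -/(cLnorm p h); case: (cLnorm p h) => [r _ _|_|//]; first exact: ltry.
  by rewrite poweRyr ?gt_eqF.
have [c ch] : exists c : cLfun p, (c : _ -> _) = h.
  by exists (CLfun mh.1 mh.2 fin).
have [F Fc] : exists F : cLspace p1, (F : _ -> _) = c %[ae mu].
  exists (\pi_(cLspace p1)%qT c).
  have : \pi_(cLspace p1)%qT (repr (\pi_(cLspace p1)%qT c)) =
      \pi_(cLspace p1)%qT c by rewrite reprK.
  by move=> /eqmodP /asboolP.
exists F; split=> [n x|f].
  rewrite -ch /fourier_sum; apply: eq_bigr => i _; congr (_ * _).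
  exact: (@fourier_coef_ae R p (repr F) c).
have mFn (k : measurableTypeR R -> R[i]) : cmeas k ->
    measurable_fun setT (fun t => (normc (f t - k t) `^ p)%:E).
  move=> mk; apply/measurable_EFinP.
  by apply: measurable_normc_powR; apply: cmeasB => //; exact: cLspace_cmeas.
have Fh : (fun t => (normc (f t - F t) `^ p)%:E) =
    (fun t => (normc (f t - h t) `^ p)%:E) %[ae mu].
  by apply: filterS Fc => t ht tT; rewrite ht// ch.
have := @ae_eq_integral _ (measurableTypeR R) R mu setT _ _ measurableT
  (mFn _ (cLspace_cmeas F)) (mFn _ mh) Fh.
by rewrite /Rintegral => ->.
Qed.

(** Dominated convergence: each point eventually leaves the sets where |f| > N. *)
Lemma truncation_small f (e : R) : 0 < e -> exists N : nat,
  \int[mu]_t (normc (f t) `^ p * \1_[set t | N%:R < normc (f t)] t) <= e.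
Proof.
move=> e0; have hp := cLspace_powR f.
pose A (N : nat) : set (measurableTypeR R) := [set t | N%:R < normc (f t)].
have mA N : measurable (A N) := measurable_normc_gt N%:R (cLspace_cmeas f).
pose F N := EFin \o (fun t => normc (f t) `^ p * \1_(A N) t).
have hF N : integ (fun t => normc (f t) `^ p * \1_(A N) t) by exact: integM_indic.
have cv t : F ^~ t @ \oo --> 0%E.
  apply: cvg_near_cst; exists (Num.trunc (normc (f t))).+1 => // n /= hn.
  rewrite /F /= indicE memNset ?mulr0//= /A /=.
  apply/negP; rewrite -leNgt ltW//.
  have /andP[_ h] := truncn_itv (normc_ge0 (f t)).
  by apply: (lt_le_trans h); rewrite ler_nat.
have dom n t : (`|F n t| <= ((normc (f t) `^ p)%R)%:E)%E.
  rewrite /F /= indicE; case: (_ \in _); rewrite ?mulr1 ?mulr0 ?normr0 ?lee_fin ?powR_ge0//.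
  by rewrite ger0_norm ?powR_ge0.
have [_ _ H] := @dominated_convergence _ (measurableTypeR R) R mu setT measurableT
  F (cst 0%E) (EFin \o (fun t => normc (f t) `^ p))
  (fun N => measurable_int _ (hF N)) (measurable_cst _)
  (aeW _ (fun t _ => cv t)) hp (aeW _ (fun t n _ => dom n t)).
rewrite integral0 in H.
have /fine_cvgP[_ /cvgr0_norm_le /(_ _ e0)[N _ /(_ N (leqnn N)) /= hN]] := H.
exists N; rewrite /Rintegral.
by apply: (le_trans (ler_norm _)).
Qed.

End LpSpace.

Section Residual.
Context (R : realType) (p : R) (p1 : 1 < p).
Let mu := @circle_measure R.
Local Notation X := (cLspace (ltW p1)).
Implicit Types (f g : X) (h : measurableTypeR R -> R[i]) (a b N m k : nat).

Let p0 : 0 < p. Proof. exact: lt_trans p1. Qed.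

(* Near each point [k / 2^(b m)], within [2^-((a + b) m) / 16], the partial sum
   of order about [2^((a + b) m)] almost has the size [2^(a m / p)] of a spike
   of norm 1. *)
Definition spiky a b N m (c : R) h : Prop :=
  forall k x, 4^-1 <= x <= 2^-1 ->
    k%:R / (2 ^ (b * m))%:R <= x <=
      k%:R / (2 ^ (b * m))%:R + (16 * (2 ^ (b * m))%:R * (2 ^ (a * m))%:R)^-1 ->
    c + 2 `^ (m%:R * (a%:R / p - N.+1%:R^-1)) <=
      normc (fourier_sum (2 ^ ((a + b) * m)).*2 h x).

Lemma powR_addr_le (x y : R) : 0 <= x -> 0 <= y ->
  (x + y) `^ p <= 2 `^ p * (x `^ p + y `^ p).
Proof.
move=> x0 y0; apply: (@le_trans _ _ ((2 * Num.max x y) `^ p)).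
  have m1 : x <= Num.max x y by rewrite le_max lexx.
  have m2 : y <= Num.max x y by rewrite le_max lexx orbT.
  have p0' := ltW p0; move: (Num.max x y) m1 m2 => z m1 m2.
  by apply: ge0_ler_powR; rewrite ?nnegrE //; lra.
rewrite powRM//; last by rewrite le_max x0.
rewrite ler_pM2l ?powR_gt0//; case: (leP x y) => _.
  by rewrite lerDr powR_ge0.
by rewrite lerDl powR_ge0.
Qed.

Lemma bounded_approx f (e : R) : 0 < e -> exists h (B : R),
  [/\ cmeas h, forall t, normc (h t) <= B,
    integ (fun t => normc (f t - h t) `^ p) &
    \int[mu]_t (normc (f t - h t) `^ p) <= e].
Proof.
move=> e0; have [B hB] := truncation_small f e0.
have mf := cLspace_cmeas f.
pose A : set (measurableTypeR R) := [set t | B%:R < normc (f t)].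
have mA : measurable A := measurable_normc_gt B%:R mf.
pose h t := f t * (\1_(~` A) t : R)%:C.
have hA t : A t -> h t = 0.
  by move=> At; rewrite /h indicE memNset ?mulr0//; apply; exact: At.
have hnA t : ~ A t -> h t = f t.
  by move=> At; rewrite /h indicE mem_set ?mulr1.
have hE t : normc (f t - h t) `^ p = normc (f t) `^ p * \1_A t.
  have [At|At] := pselect (A t).
    by rewrite hA// subr0 indicE mem_set// mulr1.
  by rewrite hnA// subrr normc0 powR0 ?gt_eqF// indicE memNset// mulr0.
have hEf : (fun t => normc (f t - h t) `^ p) = (fun t => normc (f t) `^ p * \1_A t).
  by apply/funext.
exists h, B%:R; split.
- apply: cmeasM => //; split; last exact: measurable_cst.
  by apply: measurable_indic; exact: measurableC.
- move=> t; have [At|At] := pselect (A t); first by rewrite hA// normc0.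
  by rewrite hnA// leNgt; apply/negP.
- by rewrite hEf; apply: integM_indic => //; exact: cLspace_powR.
- by rewrite hEf.
Qed.

(** The bump equals its own partial sum, so at the points considered its multiple has size at least
    e cos(1)^2 2^(a m / p). The bounded part contributes only O(m), and the loss 2^(-m / (N + 1)) in
    [spiky] absorbs the constants. *)
Lemma spiky_bump a b N h (B e : R) : 0 < e -> (0 < a)%N -> cmeas h ->
  (forall t, normc (h t) <= B) -> exists m0, forall m, (m0 <= m)%N ->
  spiky a b N m 1 (fun t => h t +
    (e * (2 ^ (a * m))%:R `^ p^-1)%:C * bump (2 ^ (b * m)) (2 ^ (a * m)) t).
Proof.
move=> e0 a0 mh hB.
have B0 : 0 <= B := le_trans (normc_ge0 _) (hB 0).
have heta : 0 < (4^-1 : R) <= 2^-1 by lra.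
have [C [C0 hC]] := fourier_sum_bounded heta.
pose e2 : R := e * cos 1 ^+ 2.
have e20 : 0 < e2 by rewrite mulr_gt0// exprn_gt0// cos1_gt0.
(* For the order used, [fourier_sum_bounded] applies with exponent (a + b) m + 3, hence with (a + b)
   m + 4 <= D (m + 1) scales. *)
pose D : R := (a + b)%:R + 4.
have [ma hma] : exists ma, forall m, (ma <= m)%N ->
    C * B * D * m.+1%:R + 1 <= e2 / 4 * 2 `^ (m%:R * (a%:R / p)).
  have gamma0 : 0 < a%:R / p by rewrite divr_gt0// ltr0n.
  have [ma hma] := linear_le_exp (4 * (C * B * D + 1) / e2) gamma0.
  exists ma => m /hma; rewrite mulrAC ler_pdivrMr// mulrC.
  have : 1 <= m.+1%:R :> R by rewrite ler1n.
  by rewrite [_ * m%:R]mulrC; lra.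
have [mb hmb] : exists mb, forall m, (mb <= m)%N ->
    2 `^ (m%:R * (a%:R / p - N.+1%:R^-1)) <= e2 / 4 * 2 `^ (m%:R * (a%:R / p)).
  have kappa0 : 0 < N.+1%:R^-1 :> R by rewrite invr_gt0 ltr0n.
  have [mb hmb] := linear_le_exp (4 / e2) kappa0.
  exists mb => m /hmb hm.
  rewrite mulrBr powRB; last by rewrite pnatr_eq0 implybT.
  rewrite ler_pdivrMr ?powR_gt0// [m%:R * N.+1%:R^-1]mulrC.
  have P0 : 0 < 2 `^ (m%:R * (a%:R / p)) :> R by rewrite powR_gt0.
  have : 4 / e2 <= 2 `^ (N.+1%:R^-1 * m%:R).
    by apply: le_trans hm; rewrite ler_peMr ?ler1n// ltW// divr_gt0.
  move: (2 `^ _) P0 (2 `^ _) => P P0 Z; rewrite ler_pdivrMr// => hZ.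
  by nra.
exists (maxn ma mb) => m; rewrite geq_max => /andP[/hma {}hma /hmb {}hmb].
move=> k x hx kx; apply: le_trans (lerD (lexx 1) hmb) _.
set P := 2 `^ (m%:R * (a%:R / p)) in hma *.
pose Q := (2 ^ (b * m))%N; pose M := (2 ^ (a * m))%N.
have Q0 : (0 < Q)%N by rewrite expn_gt0.
have M0 : (0 < M)%N by rewrite expn_gt0.
rewrite -/M -/Q; set c := e * _; set n := (2 ^ _).*2%N.
have P0 : 0 < P by rewrite powR_gt0.
have cE : c = e * P.
  rewrite /c /M natrX -powR_mulrn// -powRrM /P; congr (_ * _ `^ _).
  by rewrite natrM mulrAC mulrC.
have c0 : 0 < c by rewrite cE mulr_gt0.
have ih : cinteg h by exact: cinteg_bounded hB.
have bump1 t : normc (bump Q M t) <= 1 :> R.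
  by rewrite normc_bump exprn_ile1 ?normc_ge0// normc_spike_le.
have ib1 : cinteg (@bump R Q M) :=
  cinteg_bounded (@cmeas_bump R Q M) bump1.
rewrite fourier_sumD//; last exact: cintegZ.
rewrite fourier_sumZ// fourier_sum_bump; last first.
  by rewrite /n /M /Q -mulnA -expnD -mulnDl mul2n.
have hx' : 4^-1 <= x <= 1 - 4^-1.
  case/andP: hx => -> hx; apply: (le_trans hx).
  by rewrite lerBrDr -lerBrDl; lra.
have nN : (n.*2.+1 <= 2 ^ ((a + b) * m + 3))%N.
  rewrite /n expnD -!muln2 -mulnA.
  by rewrite -[X in (X < _)%N]addn0 -[X in (_ <= X)%N]/(2 ^ _ * (4 + 4))%N mulnDr
    -addnS leq_add// muln_gt0 expn_gt0.
have := hC h n _ x B mh hB hx' nN; set S := fourier_sum n h x => hS.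
have tri : c * normc (bump Q M x) - normc S <= normc (S + c%:C * bump Q M x).
  rewrite lerBlDr; have := ler_normcD (S + c%:C * bump Q M x) (- S).
  by rewrite addrAC subrr add0r normc_opp normcM normc_real gtr0_norm.
apply: le_trans tri.
have hS' : normc S <= C * B * D * m.+1%:R.
  apply: (le_trans hS); rewrite -[leRHS]mulrA ler_wpM2l ?mulr_ge0 ?(ltW C0)//.
  rewrite /D -(natrD _ _ 4) -natrM ler_nat [leqRHS]mulnDl -(addnS _ 3).
  by apply: leq_add; [exact: leq_mul (leqnn _) (leqnSn m)|exact: leq_pmulr].
have h3 : e2 * P <= c * normc (bump Q M x).
  rewrite cE /e2 mulrAC; apply: ler_wpM2l; first by rewrite mulr_ge0// ltW.
  exact: bump_lower_bound Q0 M0 kx.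
rewrite lerBrDr -addrA (le_trans _ h3)//.
have -> : e2 * P = e2 / 4 * P + (e2 / 4 * P) + (e2 / 4 * P) + (e2 / 4 * P) by field.
have h4 : 0 <= e2 / 4 * P by rewrite mulr_ge0 ?divr_ge0// ltW.
rewrite addrCA -!addrA lerD2l addrC.
apply: (@le_trans _ _ (e2 / 4 * P)); last by rewrite lerDl addr_ge0.
by apply: le_trans hma; rewrite lerD2r.
Qed.

(** Take a truncation of [f] plus e' M^(1/p) times a bump: in the p-th power, the factor M cancels
    the bound 1 / M on the integral of the bump. *)
Lemma spiky_dense f (e : R) a b N : 0 < e -> (0 < a)%N -> (0 < b)%N ->
  exists (g : X) m, [/\ (N <= m)%N, cLdist f g < e & spiky a b N m 1 g].
Proof.
(* Two contributions e'^p and the factor 2^p of [powR_addr_le] give at most (4 e')^p = (e / 2)^p, as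
   2 <= 2^p. *)
move=> e0 a0 b0; pose e' : R := e / 8.
have e'0 : 0 < e' by rewrite divr_gt0.
have ep0 : 0 < e' `^ p by rewrite powR_gt0.
have [g [B [mg gB ig hg]]] := bounded_approx f ep0.
have [m0 hm0] := spiky_bump b N e'0 a0 mg gB.
pose m := maxn N m0.
have : (m0 <= m)%N by rewrite leq_max leqnn orbT.
move=> /hm0 {hm0}.
set Q := (2 ^ (b * m))%N; set M := (2 ^ (a * m))%N.
set c := e' * _; set h := (fun t => _) => hspiky.
have mN : (N <= m)%N by rewrite leq_max leqnn.
have Q0 : (0 < Q)%N by rewrite expn_gt0.
have M0 : (0 < M)%N by rewrite expn_gt0.
have M0' : 0 < M%:R :> R by rewrite ltr0n.
have c0 : 0 < c by rewrite mulr_gt0// powR_gt0.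
have cp : c `^ p = e' `^ p * M%:R.
  by rewrite /c powRM ?(ltW e'0) ?powR_ge0// -powRrM mulVf ?gt_eqF// powRr1.
have mh : cmeas h.
  by apply: cmeasD => //; apply: cmeasM; [exact: cmeas_cst|exact: cmeas_bump].
have [ib hb] := int_bump_powR Q0 M0 (ltW p1).
have normc_le t : normc (f t - h t) `^ p <=
    2 `^ p * (normc (f t - g t) `^ p + c `^ p * normc (bump Q M t) `^ p).
  rewrite -powRM ?normc_ge0 ?(ltW c0)//.
  apply: le_trans (powR_addr_le (normc_ge0 _) _); last by rewrite mulr_ge0 ?normc_ge0// ltW.
  apply: ge0_ler_powR; [exact: ltW|exact: normc_ge0| |].
    by rewrite nnegrE addr_ge0 ?normc_ge0// mulr_ge0 ?normc_ge0// ltW.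
  rewrite /h opprD addrA; apply: le_trans (ler_normcD _ _) _.
  by rewrite normc_opp normcM normc_real gtr0_norm.
have irhs : integ (fun t =>
    2 `^ p * (normc (f t - g t) `^ p + c `^ p * normc (bump Q M t) `^ p)).
  by apply: integZ; apply: integD => //; exact: integZ.
have ifh : integ (fun t => normc (f t - h t) `^ p).
  apply: (integ_le _ _ irhs).
    by apply: measurable_normc_powR; apply: cmeasB => //; exact: cLspace_cmeas.
  by move=> t; rewrite ger0_norm ?powR_ge0.
have intfh : \int[mu]_t (normc (f t - h t) `^ p) <= (e / 2) `^ p.
  apply: le_trans (int_le ifh irhs normc_le) _.
  rewrite intZ; last by apply: integD => //; exact: integZ.
  rewrite intD//; last exact: integZ.
  rewrite intZ//.
  apply: (@le_trans _ _ (2 `^ p * (e' `^ p + e' `^ p))).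
    rewrite ler_pM2l ?powR_gt0//; apply: lerD => //.
    apply: (@le_trans _ _ (c `^ p * M%:R^-1)).
      by rewrite ler_wpM2l// powR_ge0.
    by rewrite cp mulfK// gt_eqF.
  have -> : (e / 2) `^ p = 2 `^ p * (2 `^ p * e' `^ p).
    have -> : e / 2 = 2 * (2 * e') by rewrite /e'; field.
    by rewrite !powRM ?mulr_ge0// ltW.
  rewrite ler_pM2l ?powR_gt0//.
  have : 2 <= 2 `^ p :> R by apply: le1r_powR; [rewrite ler1n|exact: ltW].
  by nra.
have ih : integ (fun t => normc (h t) `^ p).
  apply: (integ_le _ _ (integZ (2 `^ p) (integD (cLspace_powR f) ifh))).
    exact: measurable_normc_powR.
  move=> t; rewrite ger0_norm ?powR_ge0//.
  apply: le_trans (powR_addr_le (normc_ge0 _) (normc_ge0 _)).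
  apply: ge0_ler_powR; [exact: ltW|exact: normc_ge0| |].
    by rewrite nnegrE addr_ge0 ?normc_ge0.
  have E : h t = f t + - (f t - h t) by rewrite opprB subrKC.
  by rewrite [in leLHS]E; apply: le_trans (ler_normcD _ _) _; rewrite normc_opp.
have [F [SF dF]] := cLspace_of (ltW p1) mh ih.
exists F, m; split=> //.
  have dle : cLdist f F <= e / 2.
    by apply: cLdist_le; [rewrite divr_ge0// ltW|rewrite dF].
  by apply: (le_lt_trans dle); rewrite ltr_pdivrMr// ltr_pMr// ltr1n.
by move=> k x hx kx; rewrite SF; exact: hspiky hx kx.
Qed.

(** A union of balls, hence open. By [fourier_sum_cLdist], the radius lets the partial sum of order
    2 * 2^((a + b) m) move by at most 1, the margin granted to the centre [g]. *)
Definition spiky_near a b N : set X :=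
  [set f | exists (g : X) m, [/\ (N <= m)%N, spiky a b N m 1 g &
     cLdist g f < (4 * (2 ^ ((a + b) * m)).*2.*2.+1%:R)^-1]].

Lemma spiky_nearP a b N f : spiky_near a b N f ->
  exists2 m, (N <= m)%N & spiky a b N m 0 f.
Proof.
move=> [g [m [Nm hg gf]]]; exists m => // k x hx kx.
have := hg k x hx kx; set n := (2 ^ _).*2 in gf *.
set lam := (4 * _)^-1 in gf.
have n0 : 0 < n.*2.+1%:R :> R by rewrite ltr0n.
have lam0 : 0 < lam by rewrite invr_gt0 mulr_gt0.
have := fourier_sum_cLdist n x lam0 (ltW gf).
have -> : 4 * n.*2.+1%:R * lam = 1 by rewrite /lam mulfV// gt_eqF// mulr_gt0.
by rewrite add0r; lra.
Qed.

Lemma open_spiky_near a b N : open (spiky_near a b N).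
Proof.
rewrite openE => f [g [m [Nm hg gf]]]; set r := _^-1 in gf.
apply/nbhs_ballP; exists (r - cLdist g f) => /=; first by rewrite subr_gt0.
move=> f' ff'; exists g, m; split=> //.
have {ff'} : cLdist f f' < r - cLdist g f by rewrite ballEmdist in ff'.
rewrite ltrBrDl; apply: le_lt_trans; exact: (@metric_triangle R X g f f').
Qed.

Lemma dense_spiky_near a b N : (0 < a)%N -> (0 < b)%N ->
  dense (spiky_near a b N).
Proof.
move=> a0 b0 O [f Of] oO.
have /nbhs_ballP[e /= e0 fO] : nbhs f O by move: oO; rewrite openE; apply.
have [g [m [Nm fg hg]]] := spiky_dense f N e0 a0 b0.
exists g; split; first by apply: fO; rewrite ballEmdist.
exists g, m; split=> //.
have -> : cLdist g g = 0 by exact: (@mdistxx R X g).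
by rewrite invr_gt0 mulr_gt0// ltr0n.
Qed.

End Residual.

(** * Dimension of the level sets *)

Lemma rational_below (R : realType) (y d : R) : 0 < y < 1 -> 0 < d ->
  exists a b : nat, [/\ (0 < a)%N, (0 < b)%N,
    a%:R < y * (a + b)%:R & (y - d) * (a + b)%:R < a%:R].
Proof.
move=> /andP[y0 y1] d0; pose e := Num.min d y.
have e0 : 0 < e by rewrite lt_min d0.
have ed : e <= d by rewrite ge_min lexx.
have ey : e <= y by rewrite ge_min lexx orbT.
pose D := (Num.trunc (2 / e)).+1.
have D0 : 0 < D%:R :> R by rewrite ltr0n.
have eD : 2 < e * D%:R.
  have q0 : 0 <= 2 / e by rewrite divr_ge0// ltW.
  have /andP[_] := truncn_itv q0; rewrite -/D ltr_pdivrMr// mulrC//.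
(* As e D > 2, rounding (y - e / 2) D down lands strictly between (y - d) D and y D; this integer is
   [a], and [D] is the sum a + b. *)
have z0 : 0 <= (y - e / 2) * D%:R by rewrite mulr_ge0//; lra.
have /andP[t1 t2] := truncn_itv z0; set a := Num.trunc _ in t1 t2.
have a0 : (0 < a)%N.
  have : e / 2 * D%:R <= (y - e / 2) * D%:R by rewrite ler_pM2r//; lra.
  by rewrite -(ltr_nat R); move: t2; rewrite -(natr1 a); lra.
have aD : (a < D)%N.
  rewrite -(ltr_nat R); apply: (le_lt_trans t1).
  by rewrite -[ltRHS]mul1r ltr_pM2r//; lra.
exists a, (D - a)%N; rewrite subn_gt0 a0 aD subnKC 1?ltnW//; split=> //.
  by apply: (le_lt_trans t1); rewrite ltr_pM2r//; lra.
have : (y - d) * D%:R <= (y - e) * D%:R by rewrite ler_pM2r//; lra.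
by move: t2; rewrite -(natr1 a); lra.
Qed.

(** For the endpoint b = 0, where Lebesgue measure replaces the Cantor construction: sets of total
    cost 1/16 cover measure at most 1/8, less than 1/4. *)
Lemma not_hnull_lebesgue (R : realType) :
  ~ hnull 1 [set x : R | 4^-1 <= x <= 2^-1].
Proof.
move=> hE; have e0 : 0 < (16^-1 : R) by lra.
have {hE}[U [u [EU u0 dU sumu]]] := hE _ e0.
pose E := [set x : R | 4^-1 <= x <= 2^-1].
have /choice[c hc] : forall i, exists c, forall x, U i x -> E x ->
    c - u i <= x <= c + u i.
  move=> i; have [[c [Uc Ec]]|no] := pselect (exists c, U i c /\ E c); last first.
    by exists 0 => x Ux Ex; exfalso; apply: no; exists x.
  exists c => x Ux Ex; have := dU i x c Ux Uc.
  rewrite powRr1 ?circle_dist_ge0// circle_dist_small; last first.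
    by move: Ec Ex; rewrite /E /= ler_norml; lra.
  by rewrite ler_norml; lra.
pose V i : set (measurableTypeR R) := `[c i - u i, c i + u i]%classic.
have mV i : measurable (V i) by exact: measurable_itv.
have VE : (`[4^-1, 2^-1]%classic : set (measurableTypeR R)) `<=` \bigcup_i V i.
  move=> x; rewrite /= in_itv /= => Ex; have [i _ Ux] := EU x Ex.
  by exists i => //; rewrite /V /= in_itv/=; exact: hc.
have hV i : (@lebesgue_measure R (V i) <= (2 * u i)%:E)%E.
  have -> : @lebesgue_measure R (V i) =
      @lebesgue_measure R `[c i - u i, c i + u i]%classic by [].
  rewrite lebesgue_measure_itv /= lte_fin.
  case: ifP => _; last by rewrite lee_fin mulr_ge0.
  by rewrite -EFinD lee_fin; lra.
have m1 : @lebesgue_measure R `[4^-1, 2^-1]%classic = (4^-1)%:E.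
  rewrite lebesgue_measure_itv /= lte_fin.
  have -> : (4^-1 : R) < 2^-1 by lra.
  by rewrite -EFinD; congr EFin; lra.
suff : ((4^-1)%:E <= (8^-1 : R)%:E)%E by rewrite lee_fin; lra.
rewrite -m1; apply: le_trans (measure_sigma_subadditive _ mV _ VE) _.
  exact: measurable_itv.
apply: lime_le.
  by apply: is_cvg_ereal_nneg_natsum => i _; exact: measure_ge0.
near=> n; apply: (@le_trans _ _ (\sum_(0 <= i < n) (2 * u i)%:E)%E).
  by apply: lee_sum => i _; exact: hV.
rewrite sumEFin lee_fin big_mkord -mulr_sumr.
by have := sumu n; lra.
Unshelve. all: by end_near. Qed.

Lemma hnull_circle (R : realType) (s : R) : 1 < s -> hnull s (@circle R).
Proof.
move=> s1.
apply: (@hnull_dyadic R 1 s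
  (fun i k => 2^-1 ^+ i * (k < 2 ^ i)%N%:R) 1).
- by [].
- by move=> i k; apply: mulr_ge0 => //; exact: exprn_ge0.
- move=> i n; rewrite -mulr_sumr -natr_sum exprVn.
  rewrite mulrC ler_pdivrMr ?exprn_gt0// mul1r.
  have i1 : 1 <= (2 : R) ^+ i by rewrite exprn_ege1// ler1n.
  have := @card_le_diff R n (fun k => (k < 2 ^ i)%N) (2 ^+ i - 1).
  rewrite subrK; apply; first by rewrite subr_ge0.
  move=> k l _ _ hk _; rewrite lerBrDr -addrA addrC -lerBrDr.
  rewrite -[X in _ <= X - _]natrX.
  have : k.+1%:R <= (2 ^ i)%:R :> R by rewrite ler_nat.
  by rewrite -natr1; have : 0 <= l%:R :> R by []; lra.
- by lra.
move=> x; rewrite /circle /= in_itv /= => /andP[x0 x1] i.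
have i2 : 0 < (2 : R) ^+ i by rewrite exprn_gt0.
have x2 : 0 <= x * 2 ^+ i by rewrite mulr_ge0// ltW.
have /andP[k1 k2] := truncn_itv x2; set k := Num.trunc _ in k1 k2.
exists i, k; split=> //; first by rewrite k1 natr1.
have -> : (k < 2 ^ i)%N.
  rewrite -(ltr_nat R) natrX; apply: (le_lt_trans k1).
  by rewrite -[ltRHS]mul1r ltr_pM2r.
by rewrite mulr1 mulN1r powRN powR_mulrn// exprVn.
Qed.

(** Compares the spike size 2^(m (q - v)), with q = a / p, to k^(b - w) at the order k = 2^(D m +
    1): half of the loss [w] pays for approximating b by q / D, the other half for the [+ 1] and for
    [v]. *)
Lemma exponent_gap (R : realFieldType) (m D b w v q : R) :
  1 <= D -> 0 <= m -> b <= 1 -> 0 < w -> v <= w / 4 -> 4 <= m * w ->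
  D * (b - w / 2) <= q -> (D * m + 1) * (b - w) <= m * (q - v).
Proof.
move=> D1 m0 b1 w0 vw mw hq.
have h1 : m * (D * (b - w / 2)) <= m * q by apply: ler_wpM2l.
have h2 : m * v <= m * (w / 4) by apply: ler_wpM2l.
have h3 : 0 <= (D - 1) * (m * w) by rewrite mulr_ge0//; lra.
by lra.
Qed.

Section Main.
Context (R : realType) (p : R) (p1 : 1 < p).
Local Notation X := (cLspace (ltW p1)).

Let p0 : 0 < p. Proof. exact: lt_trans p1. Qed.

Definition large_sums (f : X) (b : R) (n : nat) : set R :=
  [set x | exists2 k, (n <= k)%N &
     k%:R `^ (b - n.+1%:R^-1) <= normc (fourier_sum k f x)].

Lemma divergence_index_ge (f : X) (b x : R) :
  (forall n, large_sums f b n x) -> b <= divergence_index f x.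
Proof.
move=> H; rewrite leNgt; apply/negP => lt.
pose c := (divergence_index f x + b) / 2.
have cb : c < b by rewrite /c; lra.
have cd : divergence_index f x < c by rewrite /c; lra.
have /bigO_powP[|K [n0 hK]] := divergence_index_lt (cLspace_cinteg f) cd.
  by move=> n; exact: normc_ge0.
(* Half of b - c absorbs 1 / (n + 1); the other half gives k^d <= |K|, which fails once k >
   |K|^(1/d). *)
pose d := (b - c) / 2; have d0 : 0 < d by rewrite /d; lra.
have dV : 0 <= d^-1 by rewrite invr_ge0 ltW.
have KV : 0 <= `|K| `^ d^-1 by exact: powR_ge0.
have /andP[_ h1] := truncn_itv dV; have /andP[_ h2] := truncn_itv KV.
pose n := maxn n0 (maxn (Num.trunc d^-1) (Num.trunc (`|K| `^ d^-1)).+1).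
have n_0 : (n0 <= n)%N by rewrite leq_max leqnn.
have n_1 : (Num.trunc d^-1 <= n)%N by rewrite !leq_max leqnn orbT.
have n_2 : ((Num.trunc (`|K| `^ d^-1)).+1 <= n)%N by rewrite !leq_max leqnn !orbT.
have [k nk hk] := H n.
have hkK := hK k (leq_trans n_0 nk).
have k1 : 1 <= k%:R :> R by rewrite ler1n; apply: leq_trans nk; apply: leq_trans n_2.
have k0 : 0 < k%:R :> R by lra.
have nd : n.+1%:R^-1 <= d.
  rewrite -[leRHS]invrK lef_pV2 ?posrE ?ltr0n ?invr_gt0//.
  by apply: ltW; apply: (lt_le_trans h1); rewrite ler_nat ltnS.
have : k%:R `^ d <= `|K|.
  have : k%:R `^ (d + c) <= K * k%:R `^ c.
    apply: le_trans hkK; apply: le_trans hk; apply: ler_powR => //.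
    by move: nd; rewrite /d; move: (n.+1%:R^-1) => z; lra.
  rewrite powRD; last by rewrite (gt_eqF k0) implybT.
  rewrite ler_pM2r ?powR_gt0// => /le_trans; apply; exact: ler_norm.
rewrite leNgt => /negP; apply.
have -> : `|K| = (`|K| `^ d^-1) `^ d by rewrite -powRrM mulVf ?gt_eqF// powRr1.
apply: gt0_ltr_powR; [by []|by rewrite nnegrE|by rewrite nnegrE ltW|].
apply: (lt_le_trans h2); rewrite ler_nat; exact: leq_trans nk.
Qed.

(** The Cantor construction with Q = 2^(c m) and r = 1 / (16 Q M), M = 2^(a m): Q r^s is a constant
    times 2^(gamma m) with gamma = b p (a + c) - a > 0, so large [m] yields its hypotheses. *)
Lemma not_hnull_divergence (f : X) (b : R) : 0 < b < p^-1 ->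
  (forall a b' N, (0 < a)%N -> (0 < b')%N -> spiky_near a b' N f) ->
  ~ hnull (1 - b * p) [set x | circle x /\ b <= divergence_index f x].
Proof.
move=> /andP[b0 bp] Hf.
have bp1 : b * p < 1 by rewrite -ltr_pdivlMr// div1r.
have bp0 : 0 < b * p by rewrite mulr_gt0.
set s := 1 - b * p.
have s01 : 0 < s <= 1 by rewrite /s; apply/andP; split; lra.
have sub : [set x | 4^-1 <= x <= 2^-1 /\ forall n, large_sums f b n x] `<=`
    [set x | circle x /\ b <= divergence_index f x].
  move=> x [/= hx H]; split; last exact: divergence_index_ge.
  by rewrite /circle /= in_itv/=; lra.
move=> /(sub_hnull sub); apply: not_hnull_cantor s01 _ => n rho /andP[rho0 rho1].
(* With w = 1 / (n + 1), an error p w / 2 on b p is what [exponent_gap] allows. *)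
have d0 : 0 < p / (2 * n.+1%:R) by rewrite divr_gt0// mulr_gt0// ltr0n.
have y01 : 0 < b * p < 1 by apply/andP; split.
have [a [c [a0 c0 aD Da]]] := rational_below y01 d0.
(* [N] provides both m w >= 4 and v <= w / 4 for [exponent_gap]; below, [m1] serves the size
   condition on the children and [m2] the condition 4 <= rho Q. *)
pose D := (a + c)%N; pose N := (4 * n.+1)%N.
pose gamma := b * p * D%:R - a%:R.
have gamma0 : 0 < gamma by rewrite subr_gt0.
have c0' : 0 < c%:R :> R by rewrite ltr0n.
have [m1 hm1] := linear_le_exp (4 * rho `^ s / (rho * 16^-1 `^ s)) gamma0.
have [m2 hm2] := linear_le_exp (4 / rho) c0'.
have [m Nm hm] := spiky_nearP (Hf a c (maxn N (maxn m1 m2)) a0 c0).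
move: Nm; rewrite !geq_max => /and3P[mN mm1 mm2].
have {hm1} := hm1 m mm1; have {hm2} := hm2 m mm2.
move=> hm2 hm1.
pose Q := (2 ^ (c * m))%N; pose M := (2 ^ (a * m))%N.
have Q0 : (0 < Q)%N by rewrite expn_gt0.
have M0 : (0 < M)%N by rewrite expn_gt0.
have Q0' : 0 < Q%:R :> R by rewrite ltr0n.
have M0' : 0 < M%:R :> R by rewrite ltr0n.
have M1 : 1 <= M%:R :> R by rewrite ler1n.
have m1' : 1 <= m.+1%:R :> R by rewrite ler1n.
exists Q, (16 * Q%:R * M%:R)^-1; split.
- by split=> //; rewrite invr_gt0 !mulr_gt0.
- have -> : 2 * (16 * Q%:R * M%:R)^-1 * Q%:R = 8^-1 * M%:R^-1 :> R.
    by field; rewrite !gt_eqF.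
  have : M%:R^-1 <= 1 :> R by rewrite invf_le1.
  by lra.
- rewrite mulrC -ler_pdivrMr// /Q natrX -powR_mulrn// natrM.
  by apply: le_trans hm2; rewrite ler_peMr// divr_ge0// ltW.
- have -> : (16 * Q%:R * M%:R)^-1 `^ s = 16^-1 `^ s * 2 `^ (- (s * (D * m)%:R)) :> R.
    rewrite -mulrA invfM powRM ?invr_ge0//.
    congr (_ * _).
    rewrite -natrM /Q /M -expnD -mulnDl addnC natrX -powR_mulrn// -powRN -powRrM.
    by congr (_ `^ _); rewrite mulNr mulrC.
  have E : Q%:R * 2 `^ (- (s * (D * m)%:R)) = 2 `^ (gamma * m%:R) :> R.
    rewrite /Q natrX -powR_mulrn// -powRD; last by rewrite pnatr_eq0 implybT.
    by congr (_ `^ _); rewrite /gamma /s !natrM /D natrD; ring.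
  have -> : Q%:R * rho * (16^-1 `^ s * 2 `^ (- (s * (D * m)%:R))) =
      rho * 16^-1 `^ s * (Q%:R * 2 `^ (- (s * (D * m)%:R))) :> R by ring.
  have u0 : 0 < rho * 16^-1 `^ s by rewrite mulr_gt0// powR_gt0.
  rewrite E [leRHS]mulrC -ler_pdivrMr//.
  apply: le_trans hm1; rewrite ler_peMr//; apply: divr_ge0; last exact: ltW.
  by apply: mulr_ge0 => //; exact: powR_ge0.
move=> k x hx kx; exists (2 ^ ((a + c) * m)).*2.
  have nm : (n <= m)%N.
    by apply: leq_trans mN; apply: leq_trans (leqnSn n) _; exact: leq_pmull.
  have n4 : (n <= 2 ^ m)%N.
    by apply: (leq_trans nm); apply: ltnW; exact: ltn_expl.
  rewrite -addnn; apply: leq_trans (leq_addr _ _); apply: leq_trans n4 _.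
  by rewrite leq_exp2l// leq_pmull// addn_gt0 a0.
have := hm k x hx kx; rewrite add0r; apply: le_trans.
have -> : (2 ^ ((a + c) * m)).*2%:R = 2 `^ ((D * m)%:R + 1) :> R.
  by rewrite -mul2n -expnS natrX -powR_mulrn// -(natr1 ((a + c) * m)).
rewrite -powRrM; apply: ler_powR; first by rewrite ler1n.
rewrite natrM; apply: exponent_gap.
- by rewrite ler1n /D addn_gt0 a0.
- by [].
- by apply: ltW; apply: (lt_trans bp); rewrite invf_lt1.
- by rewrite invr_gt0 ltr0n.
- rewrite -invfM lef_pV2 ?posrE ?mulr_gt0 ?ltr0n//.
  rewrite -natrM ler_nat mulnC; apply: leq_trans (leqnSn _).
  exact: leq_maxl.
- rewrite ler_pdivlMr ?ltr0n//.
  by rewrite -natrM ler_nat.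
- rewrite ler_pdivlMr//.
  apply: ltW; apply: le_lt_trans Da.
  rewrite /D le_eqVlt; apply/orP; left; apply/eqP; field.
  by rewrite nat1r pnatr_eq0.
Qed.

(** Points of index above [b] have index at least b + 1 / (n + 1) for some n, so they form a
    countable union of null sets. *)
Lemma divergence_level_sub (f : X) (b s : R) :
  (forall b', b < b' ->
    hnull s [set x | circle x /\ b' <= divergence_index f x]) ->
  hnull s (divergence_level b f) ->
  hnull s [set x | circle x /\ b <= divergence_index f x].
Proof.
move=> H hE.
have hU : hnull s (\bigcup_n
    [set x | circle x /\ b + n.+1%:R^-1 <= divergence_index f x]).
  by apply: hnull_bigcup => n; apply: H; rewrite ltrDl invr_gt0.
apply: (sub_hnull _ (hnullU hE hU)) => x [/= Cx].
rewrite le_eqVlt => /orP[/eqP bx|bx]; first by left; split.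
right; have d0 : 0 <= (divergence_index f x - b)^-1 by rewrite invr_ge0; lra.
have /andP[_ h] := truncn_itv d0.
exists (Num.trunc (divergence_index f x - b)^-1) => //; split=> //.
rewrite -lerBrDl -[leRHS]invrK lef_pV2 ?posrE ?invr_gt0 ?subr_gt0 ?ltr0n//.
exact: ltW.
Qed.

Lemma hausdorff_dim_level (f : X) (b : R) : 0 <= b <= p^-1 ->
  (forall a b' N, (0 < a)%N -> (0 < b')%N -> spiky_near a b' N f) ->
  hausdorff_dim (@circle_dist R) (divergence_level b f) = (1 - b * p)%:E.
Proof.
move=> /andP[b0 bp] Hf.
have up (b' s : R) : 0 < b' -> 0 < s -> 1 - b' * p < s ->
    hnull s [set x | circle x /\ b' <= divergence_index f x].
  move=> b'0 s0 hs; apply: (hnull_divergence p1 b'0 s0 hs).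
    exact: cLspace_cinteg.
  exact: cLspace_powR.
apply/eqP; rewrite eq_le; apply/andP; split.
  apply/lee_addgt0Pr => e e0; rewrite -EFinD; apply: ereal_inf_lbound.
  have bp1 : b * p <= 1 by rewrite -ler_pdivlMr// div1r.
  have s0 : 0 < 1 - b * p + e by lra.
  exists (1 - b * p + e) => //; split; first exact: ltW.
  apply: hausdorff_measure_hnull => //.
  (* The estimate [up] concerns positive exponents; for b = 0 the level set is covered by the whole
     circle. *)
  have [b00|b00] := eqVneq b 0; last first.
    apply: (sub_hnull _ (up b _ _ s0 _)); [|by rewrite lt0r b00|lra].
    by move=> x [Cx <-].
  apply: (@sub_hnull _ _ _ (@circle R)); first by move=> x [].
  by apply: hnull_circle; rewrite b00; lra.
apply: le_ereal_inf_tmp => _ [s [s0 Hs] <-]; rewrite lee_fin leNgt.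
apply/negP => ss.
(* From 0 <= s < 1 - b p; at b = 1 / p no such s exists, so the lower bound is immediate there. *)
have s10 : 0 < 1 - b * p by lra.
have hE : hnull (1 - b * p) (divergence_level b f).
  exact: (hnull_hausdorff_measure s0 (ltW ss) s10 Hs).
have hD : hnull (1 - b * p) [set x | circle x /\ b <= divergence_index f x].
  apply: divergence_level_sub hE => // b' bb'.
  by apply: up => //; [exact: le_lt_trans bb'|rewrite ltrD2l ltrN2 ltr_pM2r].
have [b00|b00] := eqVneq b 0; last first.
  apply: (not_hnull_divergence _ Hf hD); rewrite lt0r b00 b0 /=.
  by rewrite -div1r ltr_pdivlMr//; lra.
apply: (@not_hnull_lebesgue R); rewrite b00 mul0r subr0 in hD.
apply: (sub_hnull _ hD) => x /= hx; split.
  by rewrite /circle /= in_itv/=; lra.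
exact: divergence_index_ge0 (cLspace_cinteg f).
Qed.

End Main.

Unset Implicit Arguments.

Theorem theorem1p2 (R : realType) (p : R) (p1 : 1 < p) :
  residual [set f : cLspace (ltW p1) |
    forall b : R, 0 <= b <= p^-1 ->
      hausdorff_dim (@circle_dist R) (divergence_level b f) = (1 - b * p)%:E].
Proof.
(* One sequence of dense open sets serves all exponents: it enumerates the triples, with the first
   two entries shifted to be positive; codes of no triple give the whole space. *)
pose G (n : nat) : set (cLspace (ltW p1)) :=
  if unpickle n is Some (a, b, N) then spiky_near a.+1 b.+1 N else setT.
exists G; split.
  move=> n; rewrite /G; case: unpickle => [[[a b] N]|].
    by split; [exact: open_spiky_near|exact: dense_spiky_near].
  split; first exact: openT.
  by move=> O [f Of] _; exists f.
move=> f Gf b hb; apply: hausdorff_dim_level => // a b' N a0 b'0.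
have := Gf (pickle (a.-1, b'.-1, N)) I.
by rewrite /G pickleK !prednK.
Qed.
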